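(* Let $n\in\mathbb N^+$, $\varepsilon>0$ and $r_\nu=\varepsilon2^{-\nu}$ ($\nu\in\mathbb N$) be given, and let $f:\mathbb R^n\to\mathbb R$ be the limit of a sequence of functions $f_\nu(x)$, real analytic in the strips $|\operatorname{Im}x|\le r_\nu$, such that $$f_0=0,\qquad|f_\nu(x)-f_{\nu-1}(x)|\le\varphi(r_\nu)\quad\text{for }|\operatorname{Im}x|\le r_\nu,\ \nu\ge1,$$ where $\varphi$ is a nondecreasing continuous function satisfying $\varphi(0)=0$. Assume that there is a critical $k_*\in\mathbb N$ such that $$\int_0^1\frac{\varphi(x)}{x^{k_*+1}}\,dx<+\infty,\qquad\int_0^1\frac{\varphi(x)}{x^{k_*+2}}\,dx=+\infty.$$ Then there exists a modulus of continuity $\varpi_*$ such that $f\in C_{k_*,\varpi_*}(\mathbb R^n)$. In particular, $\varpi_*$ can be determined as $$\varpi_*(\gamma)\sim\gamma\int_{L(\gamma)}^{\varepsilon}\frac{\varphi(t)}{t^{k_*+2}}\,dt=\mathcal O^{\#}\Big(\int_0^{L(\gamma)}\frac{\varphi(t)}{t^{k_*+1}}\,dt\Big),\qquad\gamma\to0^+,$$ where $L(\gamma)\to0^+$ is some function such that the second relation (the one with $\mathcal O^{\#}$) holds.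
   Context: $|\cdot|$ is the sup-norm; for a multi-index $\alpha$, $|\alpha|$ is the sum of its entries. $\varphi$ is defined on an interval $[0,a]$ containing $1$ and all $r_\nu$. A real analytic function in a strip is analytic there and real valued for real arguments. Modulus of continuity: a nondecreasing continuous function $\varpi>0$ on some interval $(0,\delta]$, $\delta>0$, with $\lim_{x\to0^+}\varpi(x)=0$ and $\limsup_{x\to0^+}x/\varpi(x)<+\infty$. $[f]_\varpi:=\sup_{x,y\in\mathbb R^n,\,0<|x-y|\le\delta}\frac{|f(x)-f(y)|}{\varpi(|x-y|)}$, $|f|_{C^0}:=\sup_{\mathbb R^n}|f|$. $C_{k,\varpi}(\mathbb R^n)$ is the space of functions having continuous partial derivatives $\partial^\alpha f$ for $|\alpha|\le k$ with $\|f\|_\varpi:=\sum_{|\alpha|\le k}(|\partial^\alpha f|_{C^0}+[\partial^\alpha f]_\varpi)<+\infty$. $f_1=\mathcal O^{\#}(f_2)$ means there are positive constants $\ell_1,\ell_2$ with $\ell_1f_2\le f_1\le\ell_2f_2$ in the limit process considered; $f_1\sim f_2$ means that $f_1$ and $f_2$ are equivalent (up to positive constants) in the limit process considered. *)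

(* Defs.v *)
From HB Require Import structures.
From mathcomp Require Export all_boot all_order all_algebra.
From mathcomp Require Export complex.
From mathcomp Require Export all_classical all_reals all_analysis.

Set Implicit Arguments.
Unset Strict Implicit.
Unset Printing Implicit Defensive.
Export Order.TTheory GRing.Theory Num.Theory.
Export numFieldNormedType.Exports.

Local Open Scope classical_set_scope.
Local Open Scope complex_scope.
Local Open Scope ring_scope.

Section ComplexStrips.
Context {R : realType} {n : nat}.
Implicit Types (z w : 'rV[R[i]]_n) (F : 'rV[R[i]]_n -> R[i]).

Definition cmonomial (alpha : 'I_n -> nat) w : R[i] :=
  \prod_(i < n) w 0 i ^+ alpha i.

(* The truncation of sum_alpha c_alpha w^alpha to the multi-indices whose
   entries are all < N. *)
Definition cube_sum (c : {ffun 'I_n -> nat} -> R[i]) w (N : nat) : R[i] :=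
  \sum_(alpha : {ffun 'I_n -> 'I_N})
    c [ffun i => alpha i : nat] * cmonomial (fun i => alpha i) w.

(* Near z0, F is the sum of an absolutely convergent power series in n complex
   variables (absolute convergence makes the order of summation immaterial). *)
Definition analytic_at F z0 : Prop :=
  exists (c : {ffun 'I_n -> nat} -> R[i]) (rho : R), 0 < rho /\
    forall z, (forall i, `|z 0 i - z0 0 i| < rho%:C) ->
      (\esum_(alpha in [set: {ffun 'I_n -> nat}])
         (complex.Re `|c alpha * cmonomial alpha (z - z0)|)%:E < +oo)%E /\
      (cube_sum c (z - z0) N : R[i]^o) @[N --> \oo] --> (F z : R[i]^o).

Definition strip (r : R) : set 'rV[R[i]]_n :=
  [set z | `|map_mx (@complex.Im R) z| <= r].

Definition cvect (x : 'rV[R]_n) : 'rV[R[i]]_n := map_mx (real_complex R) x.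

Definition real_analytic_in_strip (r : R) F : Prop :=
  (forall z, strip r z -> analytic_at F z) /\
  (forall x : 'rV[R]_n, F (cvect x) \is Num.real).

End ComplexStrips.

Section Regularity.
Context {R : realType}.

Definition is_modulus (delta : R) (varpi : R -> R) : Prop :=
  [/\ 0 < delta,
      {in `]0, delta], forall x, 0 < varpi x},
      {in `]0, delta] &, {homo varpi : x y / x <= y}},
      {within `]0, delta], continuous varpi} &
      varpi x @[x --> (0 : R)^'+] --> (0 : R) /\
      (limf_esup (fun x : R => (x / varpi x)%:E) (0 : R)^'+ < +oo)%E].

Context {n : nat}.
Implicit Types f : 'rV[R]_n -> R.

Definition partial (i : 'I_n) f : 'rV[R]_n -> R :=
  fun x => 'D_(delta_mx 0 i) f x.

Definition iter_partial (s : seq 'I_n) f : 'rV[R]_n -> R := foldr partial f s.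

(* All iterated partial derivatives of order <= k, taken in any order, exist
   and are continuous. *)
Definition is_Ck (k : nat) f : Prop :=
  forall s : seq 'I_n,
    ((size s < k)%N ->
       forall i x, derivable (iter_partial s f) x (delta_mx 0 i)) /\
    ((size s <= k)%N -> continuous (iter_partial s f)).

Definition mpartial (alpha : 'I_n -> nat) f : 'rV[R]_n -> R :=
  iter_partial (flatten [seq nseq (alpha i) i | i <- enum 'I_n]) f.

Definition C0norm f : \bar R := ereal_sup [set (`|f x|)%:E | x in setT].

Definition modulus_seminorm (delta : R) (varpi : R -> R) f : \bar R :=
  ereal_sup [set (`|f p.1 - f p.2| / varpi `|p.1 - p.2|)%:E |
             p in [set p : 'rV[R]_n * 'rV[R]_n | 0 < `|p.1 - p.2| <= delta]].

(* The multi-indices with |alpha| <= k have all their entries < k + 1. *)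
Definition Ck_modulus_norm (k : nat) (delta : R) (varpi : R -> R) f : \bar R :=
  (\sum_(alpha : {ffun 'I_n -> 'I_k.+1} | (\sum_(i < n) alpha i <= k)%N)
     (C0norm (mpartial (fun i => alpha i) f) +
      modulus_seminorm delta varpi (mpartial (fun i => alpha i) f)))%E.

Definition Ck_modulus (k : nat) (delta : R) (varpi : R -> R) f : Prop :=
  is_Ck k f /\ (Ck_modulus_norm k delta varpi f < +oo)%E.

End Regularity.

Section Rates.
Context {R : realType}.

(* Used both for O^# and for ~, always as gamma -> 0+. *)
Definition same_order (f1 f2 : R -> R) : Prop :=
  exists l1 l2 : R, [/\ 0 < l1, 0 < l2 &
    \forall gamma \near (0 : R)^'+,
      l1 * f2 gamma <= f1 gamma <= l2 * f2 gamma].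

(* In the situations considered both integrals below are finite for small
   gamma > 0, so the real-valued integral loses nothing. *)
Definition upper_rate (k : nat) (eps : R) (phi L : R -> R) (gamma : R) : R :=
  gamma * \int[lebesgue_measure]_(t in `[L gamma, eps]) (phi t / t ^+ k.+2).

Definition lower_rate (k : nat) (phi L : R -> R) (gamma : R) : R :=
  \int[lebesgue_measure]_(t in `]0, L gamma]) (phi t / t ^+ k.+1).

Definition admissible (k : nat) (eps : R) (phi L : R -> R) : Prop :=
  L gamma @[gamma --> (0 : R)^'+] --> (0 : R)^'+ /\
  same_order (upper_rate k eps phi L) (lower_rate k phi L).

End Rates.

(* Main.v *)
Require Import Defs.
From mathcomp Require Import all_boot all_order all_algebra.
From mathcomp Require Import complex.
From mathcomp Require Import all_classical all_reals all_analysis.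
From mathcomp Require Import measurable_realfun.
From mathcomp Require Import ring lra.

Set Implicit Arguments.
Unset Strict Implicit.
Unset Printing Implicit Defensive.

Local Open Scope classical_set_scope.
Local Open Scope complex_scope.
Local Open Scope ring_scope.

(* By Cauchy's estimate on the strip of width r_nu, the derivatives of order j
   of f_nu - f_(nu-1) are O(phi(r_nu) / r_nu^j) on R^n, so that an increment of
   a derivative of order at most k over a distance gamma is bounded by
   min(1, gamma / r_nu) phi(r_nu) / r_nu^k, up to a constant.  With
   V(s) = int_0^s phi/t^(k+1) and U(s) = int_s^eps phi/t^(k+2), the sum over nu
   is O(V(s) + gamma U(s)) for every s in (0, eps].  The modulus is V(L(gamma)),
   where s = L(gamma) is the unique solution of V(s) = gamma U(s): it increases,
   and V(L(gamma)) / gamma = U(L(gamma)) decreases, which gives its continuity.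

   Cauchy's estimate is obtained without contour integrals.  Call a function
   locally polynomial when it is, near each point, a uniform limit of
   polynomials.  The maximum principle on squares needs only second order Taylor
   expansions; applied to polynomials it shows that division by w, and hence
   Taylor expansion and partial differentiation, preserve this class, and
   applied to (g(w) - g(0)) / w it bounds g'(0). *)

(** * Complex modulus and maximum principle *)

(** Analyticity provides one power series per centre, whereas Cauchy's estimate needs expansions at
    every point of a square. Uniform polynomial approximation avoids recentring the series: its
    truncations approximate it on a whole neighbourhood, so they serve every nearby point at once.
    Polynomials divide exactly by w, and the maximum principle controls the quotient in sup norm,
    which is what survives the passage to the limit.

    As for the rates, phi is merely monotone and no doubling property is at hand. The comparison of
    sums with integrals is therefore one-sided: the term at r is estimated by an integral over
    [r, 2r], where phi is at least phi(r).

    The divergent integral enters through positivity: a zero of phi would make phi vanish to its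
    left and the integral converge. Positivity makes V strictly increasing and U strictly decreasing
    on (0, eps]. This opposite monotonicity yields the crossing point L(gamma), the monotonicity of
    L, and the comparison of V(L(gamma)) with the rate of any other admissible function. *)

Section ComplexModulus.
Context {R : realType}.
Implicit Types (z w : R[i]) (x : R).

(** The norm of [R[i]] takes its values in [R[i]], whose order is partial; this copy lives in [R],
    where [lra] and [nra] apply. *)
Definition cabs z : R := complex.Re `|z|.

Lemma cabsE z : `|z| = (cabs z)%:C.
Proof. by rewrite /cabs normc_def. Qed.

Lemma cabs_def z : cabs z = Num.sqrt (complex.Re z ^+ 2 + complex.Im z ^+ 2).
Proof. by rewrite /cabs normc_def. Qed.

Lemma cabs_ge0 z : 0 <= cabs z.
Proof. by rewrite cabs_def sqrtr_ge0. Qed.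

Lemma cabs_sqr z : cabs z ^+ 2 = complex.Re z ^+ 2 + complex.Im z ^+ 2.
Proof. by rewrite cabs_def sqr_sqrtr// addr_ge0// sqr_ge0. Qed.

Lemma cabsM z w : cabs (z * w) = cabs z * cabs w.
Proof. by apply: complexI; rewrite rmorphM -!cabsE normrM. Qed.

Lemma cabsX z n : cabs (z ^+ n) = cabs z ^+ n.
Proof. by apply: complexI; rewrite rmorphXn -!cabsE normrX. Qed.

Lemma cabsV z : cabs z^-1 = (cabs z)^-1.
Proof. by apply: complexI; rewrite fmorphV -!cabsE normfV. Qed.

Lemma cabsN z : cabs (- z) = cabs z.
Proof. by rewrite /cabs normrN. Qed.

Lemma cabs_distC z w : cabs (z - w) = cabs (w - z).
Proof. by rewrite -cabsN opprB. Qed.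

Lemma cabsD z w : cabs (z + w) <= cabs z + cabs w.
Proof. by rewrite -lecR rmorphD -!cabsE ler_normD. Qed.

Lemma cabsB z w : cabs (z - w) <= cabs z + cabs w.
Proof. by rewrite -(cabsN w) cabsD. Qed.

Lemma cabs_real x : cabs x%:C = `|x|.
Proof. by rewrite cabs_def /= expr0n addr0 sqrtr_sqr. Qed.

Lemma cabs0 : cabs 0 = 0.
Proof. by rewrite /cabs normr0. Qed.

Lemma cabs_eq0 z : (cabs z == 0) = (z == 0).
Proof. by rewrite -(inj_eq (@complexI R)) -cabsE normr_eq0. Qed.

Lemma cabs_le0 z : cabs z <= 0 -> z = 0.
Proof. by move=> h; apply/eqP; rewrite -cabs_eq0 eq_le h cabs_ge0. Qed.

Lemma cabs_gt0 z : (0 < cabs z) = (z != 0).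
Proof. by rewrite lt_neqAle cabs_ge0 andbT eq_sym cabs_eq0. Qed.

Lemma cabs_Re z : `|complex.Re z| <= cabs z.
Proof. by rewrite -lecR -cabsE normc_ge_Re. Qed.

Lemma cabs_Im z : `|complex.Im z| <= cabs z.
Proof.
rewrite -(@ler_pXn2r _ 2) ?nnegrE ?cabs_ge0// cabs_sqr real_normK ?num_real//.
by rewrite lerDr sqr_ge0.
Qed.

Lemma cabs_le_ReIm z : cabs z <= `|complex.Re z| + `|complex.Im z|.
Proof.
rewrite -(@ler_pXn2r _ 2) ?nnegrE ?cabs_ge0 ?addr_ge0// cabs_sqr sqrrD.
by rewrite !real_normK ?num_real//; have := mulr_ge0 (normr_ge0 (complex.Re z))
  (normr_ge0 (complex.Im z)); lra.
Qed.

Lemma cabs_sub_le z w : cabs z - cabs w <= cabs (z - w).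
Proof. by have := cabsD (z - w) w; rewrite subrK; lra. Qed.

Lemma cabs_sub_norm z w : `|cabs z - cabs w| <= cabs (z - w).
Proof.
by rewrite ler_norml; have := cabs_sub_le z w; have := cabs_sub_le w z;
  rewrite (cabs_distC w); lra.
Qed.

(** Squares rather than discs: a square is a product of segments, hence compact, and it lies between
    the discs of radii h and 2h. *)
Definition csquare (h : R) z : Prop :=
  `|complex.Re z| <= h /\ `|complex.Im z| <= h.

Lemma csquare_cabs h z : csquare h z -> cabs z <= 2 * h.
Proof. by move=> [? ?]; have := cabs_le_ReIm z; lra. Qed.

Lemma cabs_csquare h z : cabs z <= h -> csquare h z.
Proof.
by move=> H; split; [apply: le_trans (cabs_Re z) H|apply: le_trans (cabs_Im z) H].
Qed.

Lemma csquare0 h : 0 <= h -> csquare h 0.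
Proof. by split; rewrite /= normr0. Qed.

Lemma csquareD h1 h2 z w : csquare h1 z -> csquare h2 w -> csquare (h1 + h2) (z + w).
Proof.
case: z w => [a b] [c d] [/= ? ?] [/= ? ?]; split => /=;
  by apply: le_trans (ler_normD _ _) _; apply: lerD.
Qed.

Lemma csquare_le h1 h2 z : h1 <= h2 -> csquare h1 z -> csquare h2 z.
Proof. by move=> h12 [? ?]; split; lra. Qed.

End ComplexModulus.

Section MaximumPrinciple.
Context {R : realType}.
Implicit Types (g : R[i] -> R[i]) (w t : R[i]).

(** Stand-in for holomorphy at w. As t is complex, the linear and quadratic terms cancel over t, -t,
    it, -it. *)
Definition taylor2 g w : Prop :=
  exists (b c : R[i]) (K d : R), [/\ 0 < d, 0 <= K &
    forall t, cabs t <= d ->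
      cabs (g (w + t) - (g w + b * t + c * t ^+ 2)) <= K * cabs t ^+ 3].

Lemma taylor2_lipschitz g w : taylor2 g w -> exists B d : R, [/\ 0 < d, 0 <= B &
    forall t, cabs t <= d -> cabs (g (w + t) - g w) <= B * cabs t].
Proof.
move=> [b [c [K [d [d0 K0 H]]]]].
exists (K + cabs b + cabs c), (Num.min d 1); split.
- by rewrite lt_min d0 ltr01.
- by rewrite !addr_ge0// cabs_ge0.
move=> t; rewrite le_min => /andP[td t1].
have := H _ td; set D := g (w + t) - _ => HD.
have -> : g (w + t) - g w = D + (b * t + c * t ^+ 2) by rewrite /D; ring.
apply: le_trans (cabsD _ _) _; apply: le_trans (lerD (lexx _) (cabsD _ _)) _.
rewrite (cabsM b) (cabsM c) cabsX.
have t0 := cabs_ge0 t; have b0 := cabs_ge0 b; have c0 := cabs_ge0 c.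
have t2 : cabs t ^+ 2 <= cabs t by rewrite expr2; nra.
have t3 : cabs t ^+ 3 <= cabs t.
  by rewrite exprS; apply: le_trans t2; have := sqr_ge0 (cabs t); nra.
have := ler_wpM2l K0 t3; have := ler_wpM2l c0 t2.
lra.
Qed.

Lemma continuous_cabs_taylor2 g (x y : R) : taylor2 g (x +i* y) ->
  {for (x, y), continuous (fun p : R * R => cabs (g (p.1 +i* p.2)))}.
Proof.
move=> /taylor2_lipschitz [B [d [d0 B0 H]]].
apply/cvgrPdist_le => e e0.
have e'0 : 0 < Num.min d (e / (B + 1)) / 2.
  by rewrite divr_gt0// lt_min d0 divr_gt0//; lra.
near=> p.
have Hp : cabs ((p.1 - x) +i* (p.2 - y)) <= Num.min d (e / (B + 1)).
  apply: le_trans (cabs_le_ReIm _) _ => /=.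
  near: p; exists (ball x (Num.min d (e / (B + 1)) / 2), ball y (Num.min d (e / (B + 1)) / 2)).
    by split=> /=; apply: (nbhsx_ballx _ _ e'0).
  by move=> [u v] [/=]; rewrite /ball /= !(distrC _ u) !(distrC _ v); lra.
move: Hp; rewrite le_min => /andP[/H].
have -> : (x +i* y) + ((p.1 - x) +i* (p.2 - y)) = p.1 +i* p.2.
  by apply/eqP; rewrite eq_complex /= ![_ + (_ - _)]addrC !subrK !eqxx.
move=> Hp; rewrite ler_pdivlMr; last lra.
move=> Hp2; rewrite distrC; apply: le_trans (cabs_sub_norm _ _) _.
by apply: le_trans Hp _; have := cabs_ge0 ((p.1 - x) +i* (p.2 - y)); lra.
Unshelve. all: by end_near.
Qed.

(* At an interior maximum w of |g| + eta (Re w)^2, the sum of g over the four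
   points w + i^j t is 4 g(w) + O(t^3), so the sum of |g| + eta (Re w)^2 over
   them exceeds 4 times the maximum by at least 2 eta t^2 - O(t^3). *)
Lemma maximum_principle g (h M : R) : 0 < h ->
  (forall w, csquare h w -> taylor2 g w) ->
  (forall w, csquare h w -> h <= cabs w -> cabs (g w) <= M) ->
  forall w, csquare h w -> cabs (g w) <= M.
Proof.
move=> h0 gT gM ws wsh; rewrite leNgt; apply/negP => Mg.
(* The perturbation is at most eta h^2 on the square, less than the excess of |g(ws)| over M, so the
   perturbed maximum cannot lie where h <= |w|. *)
pose eta := (cabs (g ws) - M) / (h ^+ 2 + 1).
have h2 : 0 < h ^+ 2 + 1 by have := sqr_ge0 h; lra.
have eta0 : 0 < eta by rewrite divr_gt0// subr_gt0.
have etaE : eta * (h ^+ 2 + 1) = cabs (g ws) - M by rewrite /eta divfK// gt_eqF.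
pose u (p : R * R) : R := cabs (g (p.1 +i* p.2)) + eta * p.1 ^+ 2.
pose A := (`[- h, h] `*` `[- h, h])%classic : set (R * R).
have AP p : A p <-> csquare h (p.1 +i* p.2).
  by rewrite /A /csquare /= !in_itv /= !ler_norml.
have A0 : A !=set0 by exists (0, 0); apply/AP; exact: csquare0 (ltW h0).
have cA : compact A by apply: compact_setX; exact: segment_compact.
have cu : {within A, continuous u}.
  apply: continuous_in_subspaceT => p /set_mem /AP /gT.
  case: p => x y /= H.
  apply: cvgD; first exact: continuous_cabs_taylor2 H.
  apply: cvgM; first exact: cvg_cst.
  by rewrite expr2; apply: cvgM; exact: cvg_fst.
have [[x y] /set_mem xyA umax] := compact_EVT_max A0 cA cu.
have {}umax p : A p -> u p <= u (x, y) by move=> /mem_set; exact: umax.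
have xyh := (AP (x, y)).1 xyA.
have usM : M + eta * h ^+ 2 < u (x, y).
  have wsE : complex.Re ws +i* complex.Im ws = ws by case: (ws).
  have := umax (complex.Re ws, complex.Im ws) ((AP (_, _)).2 _).
  rewrite /u; cbn [fst snd]; rewrite wsE => /(_ wsh).
  apply: lt_le_trans.
  by have := mulr_ge0 (ltW eta0) (sqr_ge0 (complex.Re ws)); lra.
have xint : cabs (x +i* y) < h.
  rewrite ltNge; apply/negP => hc; move: usM; rewrite /u /=.
  have := gM _ xyh hc; case: xyh => /= xh _.
  have : x ^+ 2 <= h ^+ 2 by rewrite -real_normK ?num_real// ler_pXn2r ?nnegrE// ltW.
  by move=> /(ler_wpM2l (ltW eta0)); lra.
have [b [c [K [d [d0 K0 H]]]]] := gT _ xyh.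
(* The three bounds keep the expansion valid, keep the four points in the square, and make 4 K tau^3
   < 2 eta tau^2. *)
pose tau := Num.min (Num.min d (h - cabs (x +i* y))) (eta / (2 * K + 1)).
have tau0 : 0 < tau by rewrite !lt_min d0 subr_gt0 xint divr_gt0//; lra.
have taud : tau <= d by rewrite /tau !ge_min lexx.
have tauh : cabs (x +i* y) + tau <= h.
  have : tau <= h - cabs (x +i* y) by rewrite /tau !ge_min lexx orbT.
  lra.
have tauK : tau * (2 * K + 1) <= eta.
  by rewrite -ler_pdivlMr; [rewrite /tau !ge_min lexx !orbT|lra].
have E (t : R[i]) : (complex.Re ((x +i* y) + t) +i* complex.Im ((x +i* y) + t)) = (x +i* y) + t.
  by case: t.
have four t : cabs t = tau ->
    u (complex.Re ((x +i* y) + t), complex.Im ((x +i* y) + t)) <= u (x, y).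
  move=> ct; apply: umax; apply/AP.
  cbn [fst snd]; rewrite E; apply: cabs_csquare.
  by apply: le_trans (cabsD _ _) _; rewrite ct.
pose z1 := tau%:C; pose z2 := - z1; pose z3 := 'i * z1; pose z4 := - z3.
have cz1 : cabs z1 = tau by rewrite cabs_real gtr0_norm.
have cz2 : cabs z2 = tau by rewrite cabsN.
have ci : cabs ('i : R[i]) = 1 by rewrite cabs_def /= expr0n expr1n add0r sqrtr1.
have cz3 : cabs z3 = tau by rewrite cabsM ci mul1r.
have z3E : z3 ^+ 2 = - z1 ^+ 2 by rewrite exprMn sqr_i mulN1r.
have cz4 : cabs z4 = tau by rewrite cabsN.
have := four _ cz1; have := four _ cz2; have := four _ cz3; have := four _ cz4.
rewrite /u; cbn [fst snd]; rewrite !E.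
have := H z1; have := H z2; have := H z3; have := H z4.
rewrite cz1 cz2 cz3 cz4 => /(_ taud) H4 /(_ taud) H3 /(_ taud) H2 /(_ taud) H1.
set g0 := g (x +i* y) in H1 H2 H3 H4 *.
have S : 4 * cabs g0 <= cabs (g ((x +i* y) + z1)) + cabs (g ((x +i* y) + z2)) +
    cabs (g ((x +i* y) + z3)) + cabs (g ((x +i* y) + z4)) + 4 * (K * tau ^+ 3).
  move: H1 H2 H3 H4; set d1 := g _ - _; set d2 := g _ - _; set d3 := g _ - _; set d4 := g _ - _.
  have := cabsB (g ((x +i* y) + z1) + g ((x +i* y) + z2) + g ((x +i* y) + z3) + g ((x +i* y) + z4))
     (d1 + d2 + d3 + d4).
  have -> : g ((x +i* y) + z1) + g ((x +i* y) + z2) + g ((x +i* y) + z3) + g ((x +i* y) + z4) -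
     (d1 + d2 + d3 + d4) = (4%:R : R)%:C * g0.
    rewrite /d1 /d2 /d3 /d4 /z4 /z2 rmorph_nat !sqrrN z3E; ring.
  rewrite cabsM cabs_real normr_nat.
  have := cabsD (g ((x +i* y) + z1) + g ((x +i* y) + z2) + g ((x +i* y) + z3)) (g ((x +i* y) + z4)).
  have := cabsD (g ((x +i* y) + z1) + g ((x +i* y) + z2)) (g ((x +i* y) + z3)).
  have := cabsD (g ((x +i* y) + z1)) (g ((x +i* y) + z2)).
  have := cabsD (d1 + d2 + d3) d4; have := cabsD (d1 + d2) d3; have := cabsD d1 d2.
  lra.
have -> : complex.Re ((x +i* y) + z1) = x + tau by [].
have -> : complex.Re ((x +i* y) + z2) = x - tau by [].
have -> : complex.Re ((x +i* y) + z3) = x by rewrite /= mul0r mulr0 subr0 addr0.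
have -> : complex.Re ((x +i* y) + z4) = x by rewrite /= mul0r mulr0 subr0 oppr0 addr0.
move: S tauK tau0 K0 eta0; move: (cabs _) (cabs _) (cabs _) (cabs _) (cabs _).
clearbody tau eta; clear => *.
have : 2 * eta * tau ^+ 2 <= 4 * (K * tau ^+ 3) by lra.
have -> : 4 * (K * tau ^+ 3) = (4 * K * tau) * tau ^+ 2 by ring.
rewrite ler_pM2r ?exprn_gt0//; lra.
Qed.

End MaximumPrinciple.

(** * One-variable Cauchy estimate *)

Section LocalApproximation.
Context {R : realType}.
Implicit Types (g q : R[i] -> R[i]) (p : {poly R[i]}) (w t : R[i]).

Lemma poly_quotient p : exists q : {poly R[i]}, forall t, p.[t] = p.[0] + t * q.[t].
Proof.
elim/poly_ind: p => [|p c _]; first by exists 0 => t; rewrite !horner0 mulr0 addr0.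
by exists p => t; rewrite !hornerE; ring.
Qed.

Lemma poly_bounded p (h : R) :
  exists B : R, 0 <= B /\ forall w, csquare h w -> cabs p.[w] <= B.
Proof.
elim/poly_ind: p => [|p c [B [B0 HB]]].
  by exists 0; split=> // w _; rewrite horner0 cabs0.
exists (B * (2 * `|h|) + cabs c); split.
  by rewrite addr_ge0 ?cabs_ge0// mulr_ge0// mulr_ge0.
move=> w wh; rewrite hornerMXaddC; apply: le_trans (cabsD _ _) _; rewrite lerD2r cabsM.
have := csquare_cabs wh; have := ler_norm h => hh wh2.
by apply: ler_pM; [exact: cabs_ge0|exact: cabs_ge0|exact: HB|lra].
Qed.

Lemma taylor2_poly p w : taylor2 (horner p) w.
Proof.
have [q1 H1] := poly_quotient (p \Po ('X + w%:P)).
have [q2 H2] := poly_quotient q1.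
have [q3 H3] := poly_quotient q2.
have [K [K0 HK]] := poly_bounded q3 1.
exists q1.[0], q2.[0], K, 1; split => // t t1.
have E x : (p \Po ('X + w%:P)).[x] = p.[w + x] by rewrite horner_comp !hornerE addrC.
move: (H1 t); rewrite !E addr0 H2 H3 => ->.
have -> : p.[w] + t * (q1.[0] + t * (q2.[0] + t * q3.[t])) -
  (p.[w] + q1.[0] * t + q2.[0] * t ^+ 2) = q3.[t] * t ^+ 3 by ring.
rewrite cabsM cabsX ler_wpM2r ?exprn_ge0 ?cabs_ge0//.
by apply: HK; exact: cabs_csquare.
Qed.

(** Where h <= |w|, the identity w q(w) = g(w) - g(0) gives |q| <= 2M/h; the maximum principle
    carries this bound inwards, in particular to w = 0. *)
Lemma schwarz g q (h M : R) : 0 < h ->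
  (forall w, csquare h w -> taylor2 q w) ->
  (forall w, csquare h w -> g w = g 0 + w * q w) ->
  (forall w, csquare h w -> cabs (g w) <= M) ->
  forall w, csquare h w -> cabs (q w) <= 2 * M / h.
Proof.
move=> h0 qT gq gM; apply: maximum_principle => // w wh hw.
rewrite ler_pdivlMr//.
have : cabs (w * q w) <= 2 * M.
  have -> : w * q w = g w - g 0 by rewrite gq// addrAC subrr add0r.
  apply: le_trans (cabsB _ _) _.
  by have := gM _ wh; have := gM _ (csquare0 (ltW h0)); lra.
rewrite cabsM; apply: le_trans.
by rewrite mulrC ler_wpM2r ?cabs_ge0.
Qed.

(** The intervals [x_i - d_i, x_i + d_i] meet pairwise, so the supremum of their left ends belongs
    to all of them. No order on the index type is involved; indices will be precisions e > 0 as well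
    as integers. *)
Lemma real_family_limit (I : Type) (x d : I -> R) (i0 : I) :
  (forall i j, `|x i - x j| <= d i + d j) ->
  exists l, forall i, `|x i - l| <= d i.
Proof.
move=> H; pose S := range (fun i => x i - d i); exists (sup S) => i.
have ub j : ubound S (x j + d j).
  by move=> _ [k _ <-]; have := H k j; rewrite ler_norml; lra.
rewrite ler_norml; apply/andP; split.
  have : sup S <= x i + d i by apply: ge_sup => //; exists (x i0 - d i0), i0.
  lra.
have : x i - d i <= sup S.
  by apply: ub_le_sup; [exists (x i0 + d i0)|exists i].
lra.
Qed.

Lemma complex_family_limit (I : Type) (x : I -> R[i]) (d : I -> R) (i0 : I) :
  (forall i j, cabs (x i - x j) <= d i + d j) ->
  exists l, forall i, cabs (x i - l) <= 2 * d i.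
Proof.
move=> H.
have [a Ha] : exists l, forall i, `|complex.Re (x i) - l| <= d i.
  apply: real_family_limit => // i j; apply: le_trans (H i j).
  by apply: le_trans (cabs_Re _); case: (x i) (x j) => ? ? [? ?].
have [b Hb] : exists l, forall i, `|complex.Im (x i) - l| <= d i.
  apply: real_family_limit => // i j; apply: le_trans (H i j).
  by apply: le_trans (cabs_Im _); case: (x i) (x j) => ? ? [? ?].
exists (a +i* b) => i; apply: le_trans (cabs_le_ReIm _) _.
by have := Ha i; have := Hb i; case: (x i) => u v /=; lra.
Qed.

Lemma le0_small (x C : R) : (forall e, 0 < e -> x <= C * e) -> x <= 0.
Proof.
move=> H; rewrite leNgt; apply/negP => x0.
have K0 : 0 < 2 * (`|C| + 1) by have := normr_ge0 C; lra.
pose y := x / (2 * (`|C| + 1)).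
have yE : y * (2 * (`|C| + 1)) = x by rewrite /y divfK// gt_eqF.
have y0 : 0 < y by rewrite divr_gt0.
by have := H _ y0; have := ler_norm C; nra.
Qed.

Definition poly_approx (rho : R) g : Prop := forall e : R, 0 < e ->
  exists p : {poly R[i]}, forall w, csquare rho w -> cabs (g w - p.[w]) <= e.

Lemma poly_approx_bounded rho g : poly_approx rho g ->
  exists B : R, 0 <= B /\ forall w, csquare rho w -> cabs (g w) <= B.
Proof.
move=> /(_ 1 ltr01)[p Hp]; have [B [B0 HB]] := poly_bounded p rho.
exists (1 + B); split; first lra.
by move=> w wr; have := Hp _ wr; have := HB _ wr; have := cabs_sub_le (g w) p.[w]; lra.
Qed.

(** By [schwarz], close approximants of g have close quotients, uniformly on the square. The
    quotients thus form a Cauchy family indexed by the precision, and its limit is a quotient of g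
    that is defined at w = 0 too. *)
Lemma poly_approx_quotient rho g : 0 < rho -> poly_approx rho g ->
  exists g1, poly_approx rho g1 /\ forall w, csquare rho w -> g w = g 0 + w * g1 w.
Proof.
move=> rho0 gA.
pose I := {e : R | 0 < e}.
have /choice[p pP] : forall e : I, exists p : {poly R[i]},
    forall w, csquare rho w -> cabs (g w - p.[w]) <= val e.
  by move=> [e e0]; exact: gA.
have /choice[q qP] : forall e : I, exists q : {poly R[i]},
    forall t, (p e).[t] = (p e).[0] + t * q.[t].
  by move=> e; exact: poly_quotient.
have qC w : csquare rho w -> forall e1 e2,
    cabs ((q e1).[w] - (q e2).[w]) <= 2 * val e1 / rho + 2 * val e2 / rho.
  move=> wr e1 e2; rewrite -mulrDl -mulrDr -hornerN -hornerD.
  apply: (@schwarz (horner (p e1 - p e2)) (horner (q e1 - q e2))) wr => //.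
  - by move=> *; exact: taylor2_poly.
  - by move=> v _; rewrite !hornerE (qP e1 v) (qP e2 v); ring.
  - move=> v vr; rewrite !hornerE.
    have -> : (p e1).[v] - (p e2).[v] = (g v - (p e2).[v]) - (g v - (p e1).[v]) by ring.
    apply: le_trans (cabsB _ _) _.
    by have := pP e1 _ vr; have := pP e2 _ vr; lra.
have i0 : I by exists 1; exact: ltr01.
have /choice[g1 g1P] : forall w, exists l, csquare rho w ->
    forall e, cabs ((q e).[w] - l) <= 2 * (2 * val e / rho).
  move=> w; case: (pselect (csquare rho w)) => [wr|nwr]; last by exists 0.
  by have [l lP] := complex_family_limit i0 (qC _ wr); exists l.
exists g1; split.
  move=> e e0.
  have e'0 : 0 < e * rho / 4 by rewrite divr_gt0// mulr_gt0.
  (* At precision e' the quotient is within 2 (2 e' / rho) of its limit: a factor 2 from [schwarz],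
     another from treating real and imaginary parts separately. *)
  exists (q (exist _ (e * rho / 4) e'0 : I)) => w wr; rewrite cabs_distC.
  apply: le_trans (g1P _ wr _) _; rewrite /=.
  by rewrite le_eqVlt; apply/orP; left; apply/eqP; field; rewrite gt_eqF.
move=> w wr; apply/eqP; rewrite -subr_eq0; apply/eqP/cabs_le0.
apply: (@le0_small _ (2 + cabs w * (4 / rho))) => e e0.
pose i : I := exist _ e e0.
have := pP i _ wr; have := pP i _ (csquare0 (ltW rho0)); have := g1P _ wr i.
move=> /(ler_wpM2l (cabs_ge0 w)); rewrite -cabsM /=.
have -> : g w - (g 0 + w * g1 w) =
  (g w - (p i).[w]) - (g 0 - (p i).[0]) + (w * ((q i).[w] - g1 w)) by rewrite (qP i w); ring.
set A := g w - _; set B := g 0 - _; set D := w * (_ - _).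
have := cabsD (A - B) D; have := cabsB A B.
have -> : cabs w * (2 * (2 * e / rho)) = cabs w * (4 / rho) * e by field; rewrite gt_eqF.
lra.
Qed.

Lemma poly_approx_taylor2 rho g : 0 < rho -> poly_approx rho g -> taylor2 g 0.
Proof.
move=> r0 gA.
have [g1 [A1 H1]] := poly_approx_quotient r0 gA.
have [g2 [A2 H2]] := poly_approx_quotient r0 A1.
have [g3 [A3 H3]] := poly_approx_quotient r0 A2.
have [K [K0 HK]] := poly_approx_bounded A3.
exists (g1 0), (g2 0), K, rho; split => // t tr; have {}tr := cabs_csquare tr.
rewrite add0r H1// H2// H3//.
have -> : g 0 + t * (g1 0 + t * (g2 0 + t * g3 t)) - (g 0 + g1 0 * t + g2 0 * t ^+ 2) =
  g3 t * t ^+ 3 by ring.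
by rewrite cabsM cabsX ler_wpM2r ?exprn_ge0 ?cabs_ge0// HK.
Qed.

Lemma taylor2_shift g w : taylor2 (fun t => g (w + t)) 0 -> taylor2 g w.
Proof.
move=> [b [c [K [d [d0 K0 H]]]]]; exists b, c, K, d; split => // t td.
by have := H t td; rewrite !add0r addr0.
Qed.

Lemma taylor2_local g q w (d : R) : 0 < d ->
  (forall t, cabs t <= d -> g (w + t) = q (w + t)) -> taylor2 q w -> taylor2 g w.
Proof.
move=> d0 E [b [c [K [d' [d'0 K0 H]]]]].
exists b, c, K, (Num.min d d'); split; rewrite ?lt_min ?d0// => t.
rewrite le_min => /andP[td td']; rewrite E//.
by have := E 0; rewrite cabs0 addr0 => /(_ (ltW d0)) ->; exact: H.
Qed.

Lemma taylor2_quotient g q w : w != 0 -> taylor2 g w ->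
  (forall t, t != 0 -> q t = (g t - g 0) / t) -> taylor2 q w.
Proof.
move=> w0 [b [c [K [d [d0 K0 H]]]]] qE.
(* Division of g(w) - g(0) + b t + c t^2 by w + t in powers of t: a' w = g(w) - g(0), b' w + a' = b,
   c' w + b' = c. What is left over is c' t^3, of the order of the remainder. *)
pose a' := (g w - g 0) / w; pose b' := (b - a') / w; pose c' := (c - b') / w.
have aw : a' * w = g w - g 0 by rewrite /a' divfK.
have bw : b' * w = b - a' by rewrite /b' divfK.
have cw : c' * w = c - b' by rewrite /c' divfK.
have cw0 : 0 < cabs w by rewrite cabs_gt0.
exists b', c', ((K + cabs c') / (cabs w / 2)), (Num.min d (cabs w / 2)).
split; first by rewrite lt_min d0 divr_gt0.
  by rewrite divr_ge0 ?addr_ge0 ?cabs_ge0 ?divr_ge0 ?cabs_ge0.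
move=> t; rewrite le_min => /andP[td tw].
have wt : cabs w / 2 <= cabs (w + t).
  by have := cabs_sub_le w (- t); rewrite cabsN opprK; lra.
have wt0 : w + t != 0 by rewrite -cabs_gt0; lra.
rewrite qE// [q w]qE// -/a'; clearbody a' b' c'.
have -> : (g (w + t) - g 0) / (w + t) - (a' + b' * t + c' * t ^+ 2) =
  ((g (w + t) - (g w + b * t + c * t ^+ 2)) - c' * t ^+ 3) / (w + t).
  apply: (mulIf wt0); rewrite mulrBl !divfK//.
  have -> : (a' + b' * t + c' * t ^+ 2) * (w + t) = a' * w + (b' * w + a') * t +
    (c' * w + b') * t ^+ 2 + c' * t ^+ 3 by ring.
  rewrite aw bw cw; ring.
rewrite cabsM cabsV [leRHS]mulrAC.
apply: ler_pM; rewrite ?cabs_ge0 ?invr_ge0 ?cabs_ge0//.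
  apply: le_trans (cabsB _ _) _; rewrite mulrDl.
  by apply: lerD; [exact: H|rewrite cabsM cabsX].
by rewrite lef_pV2 ?posrE//; lra.
Qed.

(** The error is O(t^2) rather than o(t), as [taylor2] supplies it; later estimates can then simply
    add the constants K. *)
Definition cderiv g w (b : R[i]) : Prop := exists K d : R, 0 < d /\
  forall t, cabs t <= d -> cabs (g (w + t) - g w - b * t) <= K * cabs t ^+ 2.

Lemma cderiv_unique g w b1 b2 : cderiv g w b1 -> cderiv g w b2 -> b1 = b2.
Proof.
move=> [K1 [d1 [d10 H1]]] [K2 [d2 [d20 H2]]].
apply/eqP; rewrite -subr_eq0; apply/eqP/cabs_le0.
rewrite leNgt; apply/negP => b0.
pose t := Num.min (Num.min d1 d2) (cabs (b1 - b2) / (2 * (`|K1| + `|K2| + 1))).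
have Kn1 := normr_ge0 K1; have Kn2 := normr_ge0 K2.
have K0 : 0 < 2 * (`|K1| + `|K2| + 1) by lra.
have t0 : 0 < t by rewrite !lt_min d10 d20 divr_gt0.
have ct : cabs t%:C = t by rewrite cabs_real gtr0_norm.
have /H1 A1 : cabs t%:C <= d1 by rewrite ct /t !ge_min lexx.
have /H2 A2 : cabs t%:C <= d2 by rewrite ct /t !ge_min lexx !orbT.
rewrite !ct in A1 A2.
have : cabs ((b1 - b2) * t%:C) <= K1 * t ^+ 2 + K2 * t ^+ 2.
  have -> : (b1 - b2) * t%:C = (g (w + t%:C) - g w - b2 * t%:C) - (g (w + t%:C) - g w - b1 * t%:C).
    by ring.
  by apply: le_trans (cabsB _ _) _; lra.
rewrite cabsM ct -mulrDl expr2 mulrA ler_pM2r//.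
have : t * (2 * (`|K1| + `|K2| + 1)) <= cabs (b1 - b2).
  by rewrite -ler_pdivlMr// /t !ge_min lexx !orbT.
have := ler_norm K1; have := ler_norm K2; nra.
Qed.

Lemma taylor2_cderiv g w : taylor2 g w -> exists b, cderiv g w b.
Proof.
move=> [b [c [K [d [d0 K0 H]]]]]; exists b, (cabs c + K), (Num.min d 1).
split; first by rewrite lt_min d0 ltr01.
move=> t; rewrite le_min => /andP[/H Ht t1].
have -> : g (w + t) - g w - b * t = (g (w + t) - (g w + b * t + c * t ^+ 2)) + c * t ^+ 2 by ring.
apply: le_trans (cabsD _ _) _; rewrite (cabsM c) cabsX.
have : K * cabs t ^+ 3 <= K * cabs t ^+ 2.
  rewrite ler_wpM2l// exprS; have := sqr_ge0 (cabs t); have := cabs_ge0 t; nra.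
lra.
Qed.

Definition locally_poly g w : Prop :=
  exists2 rho, 0 < rho & poly_approx rho (fun t => g (w + t)).

Lemma locally_poly_taylor2 g w : locally_poly g w -> taylor2 g w.
Proof.
by move=> [rho r0 H]; apply: taylor2_shift; exact: poly_approx_taylor2 H.
Qed.

Lemma cauchy_estimate g b (h M : R) : 0 < h ->
  (forall w, csquare h w -> locally_poly g w) ->
  (forall w, csquare h w -> cabs (g w) <= M) ->
  cderiv g 0 b -> cabs b <= 2 * M / h.
Proof.
move=> h0 gL gM gb.
pose q t := if t == 0 then b else (g t - g 0) / t.
have <- : q 0 = b by rewrite /q eqxx.
apply: (@schwarz g q) => //; last exact: csquare0 (ltW h0); last first.
  move=> w wh; rewrite /q; case: eqVneq => [->|w0]; first by rewrite mul0r addr0.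
  by rewrite mulrCA divff// mulr1 addrC subrK.
move=> w wh; have [->|w0] := eqVneq w 0; last first.
  apply: (@taylor2_quotient g) => //; first exact: locally_poly_taylor2 (gL _ wh).
  by move=> t /negbTE t0; rewrite /q t0.
have [rho r0 gA] := gL _ (csquare0 (ltW h0)).
have {}gA : poly_approx rho g.
  by move=> e /gA[p Hp]; exists p => t /Hp; rewrite add0r.
have [g1 [A1 H1]] := poly_approx_quotient r0 gA.
have T1 := poly_approx_taylor2 r0 A1.
(* Dividing an expansion by w fails at w = 0. There q is compared with the quotient [g1] obtained
   from approximants; at the point 0 itself they agree because [g1 0] is also a derivative of g,
   hence equals b. *)
apply: (@taylor2_local _ g1 _ rho) => // t tr; rewrite add0r /q.
case: eqVneq => [->|t0]; last first.
  by rewrite (H1 t (cabs_csquare tr)) addrAC subrr add0r mulrAC divff// mul1r.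
apply: cderiv_unique gb _; have [B [d [d0 B0 HB]]] := taylor2_lipschitz T1.
exists B, (Num.min rho d); split; first by rewrite lt_min r0 d0.
move=> s; rewrite le_min => /andP[sr sd]; rewrite add0r (H1 s (cabs_csquare sr)).
have -> : g 0 + s * g1 s - g 0 - g1 0 * s = (g1 s - g1 0) * s by ring.
rewrite cabsM expr2 mulrA ler_wpM2r ?cabs_ge0//.
by have := HB _ sd; rewrite add0r.
Qed.

End LocalApproximation.

(** * Functions of several complex variables *)

Section SeveralVariables.
Context {R : realType} {n : nat}.
Implicit Types (G : 'rV[R[i]]_n -> R[i]) (z : 'rV[R[i]]_n) (w t : R[i]) (i j : 'I_n).

(** Only closure properties and slices of polynomials in several variables matter, so the functions
    they define are generated inductively. *)
Inductive polyfun : ('rV[R[i]]_n -> R[i]) -> Prop :=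
| polyfun_cst c : polyfun (fun=> c)
| polyfun_coord j : polyfun (fun z => z 0 j)
| polyfun_add P Q : polyfun P -> polyfun Q -> polyfun (fun z => P z + Q z)
| polyfun_mul P Q : polyfun P -> polyfun Q -> polyfun (fun z => P z * Q z).

Definition slice i G z w := G (z + w *: delta_mx 0 i).

Lemma slice_coord i z w j :
  (z + w *: delta_mx 0 i) 0 j = z 0 j + w * (j == i)%:R.
Proof. by rewrite !mxE eqxx. Qed.

Lemma sliceD i G z w t : slice i G z (w + t) = slice i G (z + w *: delta_mx 0 i) t.
Proof. by rewrite /slice scalerDl addrA. Qed.

(** Q is the i-th partial derivative of P. It must be polynomial in z, since it will approximate the
    derivative of a limit; the remainder r may depend on z in any manner. *)
Lemma polyfun_slice i P : polyfun P -> exists2 Q, polyfun Q &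
  forall z, exists r : {poly R[i]}, forall w, slice i P z w = P z + w * Q z + w ^+ 2 * r.[w].
Proof.
elim=> [c|j|P1 P2 p1 [Q1 q1 H1] p2 [Q2 q2 H2]|P1 P2 p1 [Q1 q1 H1] p2 [Q2 q2 H2]].
- exists (fun=> 0); first exact: polyfun_cst.
  by move=> z; exists 0 => w; rewrite horner0 !mulr0 !addr0.
- exists (fun=> (j == i)%:R); first exact: polyfun_cst.
  by move=> z; exists 0 => w; rewrite /slice slice_coord horner0 mulr0 addr0.
- exists (fun z => Q1 z + Q2 z); first exact: polyfun_add.
  move=> z; have [r1 R1] := H1 z; have [r2 R2] := H2 z; exists (r1 + r2) => w.
  rewrite /slice in R1 R2 *; rewrite R1 R2 hornerD; ring.
- exists (fun z => P1 z * Q2 z + Q1 z * P2 z).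
    by apply: polyfun_add; exact: polyfun_mul.
  move=> z; have [r1 R1] := H1 z; have [r2 R2] := H2 z.
  exists ((P1 z)%:P * r2 + (Q1 z * Q2 z)%:P + r1 * (P2 z)%:P
    + 'X * ((Q1 z)%:P * r2 + r1 * (Q2 z)%:P) + 'X ^+ 2 * (r1 * r2)) => w.
  rewrite /slice in R1 R2 *; rewrite R1 R2 !(hornerD, hornerM, hornerC, hornerX, hornerXn). ring.
Qed.

Definition near_by (rho : R) z0 z := forall j, csquare rho (z 0 j - z0 0 j).

Definition mpoly_approx (rho : R) z0 G : Prop := forall e : R, 0 < e ->
  exists2 P, polyfun P & forall z, near_by rho z0 z -> cabs (G z - P z) <= e.

Definition locally_mpoly G z0 : Prop :=
  exists2 rho, 0 < rho & mpoly_approx rho z0 G.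

Lemma near_by_slice i (r1 r2 : R) z0 z w : 0 <= r2 ->
  near_by r1 z0 z -> csquare r2 w -> near_by (r1 + r2) z0 (z + w *: delta_mx 0 i).
Proof.
move=> r0 zz wr j; rewrite slice_coord addrAC; apply: csquareD => //.
by case: (j == i); rewrite ?mulr1 ?mulr0//; exact: csquare0.
Qed.

Lemma near_by_refl (r : R) z : 0 <= r -> near_by r z z.
Proof. by move=> r0 j; rewrite subrr; exact: csquare0. Qed.

Lemma mpoly_approx_slice i (r1 r2 : R) z0 z G : 0 <= r2 -> mpoly_approx (r1 + r2) z0 G ->
  near_by r1 z0 z -> poly_approx r2 (slice i G z).
Proof.
move=> r0 GA zz e /GA[P /(polyfun_slice i)[Q _ /(_ z)[r H]] PG].
exists ((P z)%:P + 'X * (Q z)%:P + 'X ^+ 2 * r) => w wr.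
have -> : ((P z)%:P + 'X * (Q z)%:P + 'X ^+ 2 * r).[w] = slice i P z w.
  by rewrite H !hornerE.
exact: PG (near_by_slice i r0 zz wr).
Qed.

Lemma mpoly_approx_le (r1 r2 : R) z0 G : r1 <= r2 ->
  mpoly_approx r2 z0 G -> mpoly_approx r1 z0 G.
Proof.
move=> r12 GA e /GA[P PP H]; exists P => // z zz; apply: H => j.
exact: csquare_le r12 (zz j).
Qed.

Lemma mpoly_approxB (rho : R) z0 G1 G2 : mpoly_approx rho z0 G1 ->
  mpoly_approx rho z0 G2 -> mpoly_approx rho z0 (fun z => G1 z - G2 z).
Proof.
move=> A1 A2 e e0; have e2 : 0 < e / 2 by lra.
have [P1 p1 H1] := A1 _ e2; have [P2 p2 H2] := A2 _ e2.
exists (fun z => P1 z + -1 * P2 z).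
  by apply: polyfun_add => //; apply: polyfun_mul => //; exact: polyfun_cst.
move=> z zz.
have -> : G1 z - G2 z - (P1 z + -1 * P2 z) = (G1 z - P1 z) - (G2 z - P2 z) by ring.
by apply: le_trans (cabsB _ _) _; have := H1 _ zz; have := H2 _ zz; lra.
Qed.

Lemma mpoly_approx_polyfun (rho : R) z0 P : polyfun P -> mpoly_approx rho z0 P.
Proof.
by move=> PP e e0; exists P => // z _; rewrite subrr cabs0 ltW.
Qed.

Lemma locally_mpolyB z0 G1 G2 : locally_mpoly G1 z0 -> locally_mpoly G2 z0 ->
  locally_mpoly (fun z => G1 z - G2 z) z0.
Proof.
move=> [r1 r10 A1] [r2 r20 A2]; exists (Num.min r1 r2); first by rewrite lt_min r10.
apply: mpoly_approxB; [apply: mpoly_approx_le A1|apply: mpoly_approx_le A2];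
  by rewrite ge_min lexx ?orbT.
Qed.

Lemma locally_mpoly_slice i z w G :
  locally_mpoly G (z + w *: delta_mx 0 i) -> locally_poly (slice i G z) w.
Proof.
move=> [rho r0 GA]; exists rho => //.
have -> : (fun t => slice i G z (w + t)) = slice i G (z + w *: delta_mx 0 i).
  by apply/funext => t; rewrite sliceD.
apply: (@mpoly_approx_slice i 0 rho (z + w *: delta_mx 0 i)).
- exact: ltW.
- by rewrite add0r.
- exact: near_by_refl.
Qed.

(** The set has at most one element by [cderiv_unique]; the value is 0 where there is no
    derivative. *)
Definition cpartial i G z : R[i] := xget 0 [set b | cderiv (slice i G z) 0 b].

Lemma cpartialP i G z : locally_mpoly G z -> cderiv (slice i G z) 0 (cpartial i G z).
Proof.
move=> GL; rewrite /cpartial; apply: xgetPex.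
apply: taylor2_cderiv; apply: locally_poly_taylor2.
by apply: locally_mpoly_slice; rewrite scale0r addr0.
Qed.

Lemma cpartial_bound i G z (h M : R) : 0 < h ->
  (forall w, csquare h w -> locally_mpoly G (z + w *: delta_mx 0 i)) ->
  (forall w, csquare h w -> cabs (G (z + w *: delta_mx 0 i)) <= M) ->
  cabs (cpartial i G z) <= 2 * M / h.
Proof.
move=> h0 GL GM; apply: (@cauchy_estimate _ (slice i G z)) => //.
- by move=> w /GL; exact: locally_mpoly_slice.
- by apply: cpartialP; have := GL _ (csquare0 (ltW h0)); rewrite scale0r addr0.
Qed.

(** If P is close to G, Cauchy's estimate for G - P shows that the derivative Q of P is close to
    that of G. For z within rho/4 of z0, the square of radius rho/4 about z stays within rho/2,
    leaving room rho/2 for approximating slices at each of its points. *)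
Lemma locally_mpoly_cpartial i G z0 :
  locally_mpoly G z0 -> locally_mpoly (cpartial i G) z0.
Proof.
move=> [rho r0 GA]; exists (rho / 4); first lra.
have s0 : 0 < rho / 4 by lra.
move=> e e0; have e'0 : 0 < e * (rho / 4) / 2 by rewrite divr_gt0// mulr_gt0.
have [P PP PG] := GA _ e'0; have [Q QQ PQ] := polyfun_slice i PP.
exists Q => // z zz.
have -> : e = 2 * (e * (rho / 4) / 2) / (rho / 4) by field; rewrite gt_eqF.
have near2 w : csquare (rho / 4) w -> near_by (rho / 2) z0 (z + w *: delta_mx 0 i).
  move=> wr; have -> : rho / 2 = rho / 4 + rho / 4 by field.
  by apply: near_by_slice => //; exact: ltW.
apply: (@cauchy_estimate _ (slice i (fun z => G z - P z) z)) => //.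
- move=> w /near2 wr; exists (rho / 2); first lra.
  have -> : (fun t => slice i (fun z => G z - P z) z (w + t)) =
      slice i (fun z => G z - P z) (z + w *: delta_mx 0 i).
    by apply/funext => t; rewrite sliceD.
  apply: mpoly_approx_slice wr; first lra.
  have -> : rho / 2 + rho / 2 = rho by field.
  by apply: mpoly_approxB => //; exact: mpoly_approx_polyfun.
- move=> w /near2 wr; apply: PG => j; apply: csquare_le (wr j); lra.
have GLz : locally_mpoly G z.
  exists (rho / 2); first lra.
  move=> e1 /GA[P1 PP1 H1]; exists P1 => // z1 zz1; apply: H1 => j.
  rewrite -[_ - _](subrKA (z 0 j)); apply: (@csquare_le _ (rho / 2 + rho / 4)); first lra.
  exact: csquareD.
have [K [d [d0 H]]] := cpartialP i GLz.
have [r Pr] := PQ z; have [B [B0 HB]] := poly_bounded r d.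
exists (K + B), d; split => // t td.
have Ht := H t td; rewrite /slice !add0r !scale0r !addr0 in Ht *.
rewrite -![P (_ + _)]/(slice i P z t) Pr.
set A := G (z + t *: _) in Ht *.
have -> : A - (P z + t * Q z + t ^+ 2 * r.[t]) - (G z - P z) - (cpartial i G z - Q z) * t =
  (A - G z - cpartial i G z * t) - r.[t] * t ^+ 2 by ring.
apply: le_trans (cabsB _ _) _; rewrite mulrDl (cabsM r.[t]) cabsX.
by apply: lerD => //; rewrite ler_wpM2r ?sqr_ge0//; apply: HB; exact: cabs_csquare.
Qed.

(** * Power series as uniform limits of polynomials *)

(** The index type of [cube_sum] changes with N; here all truncations range over one type, so they
    can be subtracted. *)
Definition cube N : seq {ffun 'I_n -> nat} :=
  [seq [ffun i => alpha i : nat] | alpha : {ffun 'I_n -> 'I_N}].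

Lemma cube_uniq N : uniq (cube N).
Proof.
rewrite map_inj_uniq ?enum_uniq// => a b /ffunP ab; apply/ffunP => i.
by apply: val_inj; have := ab i; rewrite !ffunE.
Qed.

Lemma mem_cube N (alpha : {ffun 'I_n -> nat}) :
  (alpha \in cube N) = [forall i, (alpha i < N)%N].
Proof.
apply/idP/forallP => [/mapP[b _ ->] i|H]; first by rewrite ffunE.
apply/mapP; exists [ffun i => Ordinal (H i)]; first by rewrite mem_enum.
by apply/ffunP => i; rewrite !ffunE.
Qed.

Lemma cube_sumE (c : {ffun 'I_n -> nat} -> R[i]) z N :
  cube_sum c z N = \sum_(alpha <- cube N) c alpha * cmonomial alpha z.
Proof.
rewrite big_image /cube_sum; apply: eq_bigr => a _; congr (_ * _).
by apply: eq_bigr => i _; rewrite ffunE.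
Qed.

Lemma cube_sumD (V : nmodType) (f : {ffun 'I_n -> nat} -> V) N M : (N <= M)%N ->
  \sum_(alpha <- cube M) f alpha = \sum_(alpha <- cube N) f alpha +
    \sum_(alpha <- cube M | alpha \notin cube N) f alpha.
Proof.
move=> NM; rewrite (bigID (mem (cube N))) /=; congr (_ + _).
rewrite -big_filter; apply: perm_big; apply: uniq_perm.
- by rewrite filter_uniq// cube_uniq.
- exact: cube_uniq.
- move=> a; rewrite mem_filter /= andb_idr// !mem_cube => /forallP H.
  by apply/forallP => i; apply: leq_trans (H i) NM.
Qed.

Lemma polyfun_sum (I : Type) (s : seq I) (P : I -> 'rV[R[i]]_n -> R[i]) :
  (forall k, polyfun (P k)) -> polyfun (fun z => \sum_(k <- s) P k z).
Proof.
move=> PP; elim: s => [|k s IH].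
  by under eq_fun do rewrite big_nil; exact: polyfun_cst.
by under eq_fun do rewrite big_cons; exact: polyfun_add.
Qed.

Lemma polyfun_cmonomial z0 (alpha : 'I_n -> nat) : polyfun (fun z => cmonomial alpha (z - z0)).
Proof.
rewrite /cmonomial; elim: (index_enum _) => [|i s IH].
  by under eq_fun do rewrite big_nil; exact: polyfun_cst.
under eq_fun do rewrite big_cons; apply: polyfun_mul => //.
elim: (alpha i) => [|m IHm]; first by under eq_fun do rewrite expr0; exact: polyfun_cst.
under eq_fun do rewrite exprS; apply: polyfun_mul => //.
under eq_fun do rewrite !mxE; apply: polyfun_add; [exact: polyfun_coord|exact: polyfun_cst].
Qed.

Lemma cabs_cmonomial_le (alpha : 'I_n -> nat) z z1 :
  (forall j, cabs (z 0 j) <= cabs (z1 0 j)) ->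
  cabs (cmonomial alpha z) <= cabs (cmonomial alpha z1).
Proof.
move=> H; rewrite /cmonomial; elim/big_ind2: _ => //.
  move=> a b c d ab cd; rewrite !cabsM.
  by apply: ler_pM => //; exact: cabs_ge0.
move=> i _; rewrite !cabsX; apply: lerXn2r; rewrite ?nnegrE ?cabs_ge0//.
Qed.

Lemma cabs_sum (I : Type) (s : seq I) (P : pred I) (F : I -> R[i]) :
  cabs (\sum_(k <- s | P k) F k) <= \sum_(k <- s | P k) cabs (F k).
Proof.
elim/big_ind2: _ => //; first by rewrite cabs0.
by move=> a b c d ab cd; apply: le_trans (cabsD _ _) (lerD ab cd).
Qed.

Lemma cvg_cabs (u : nat -> R[i]) (l : R[i]) :
  (u N : R[i]^o) @[N --> \oo] --> (l : R[i]^o) ->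
  forall e : R, 0 < e -> \forall N \near \oo, cabs (l - u N) <= e.
Proof.
move=> /cvgrPdist_le H e e0.
have e'0 : 0 < e%:C by rewrite ltcR.
have := H _ e'0; apply: filterS => N.
by rewrite cabsE lecR.
Qed.

(** Weierstrass test: absolute convergence at the single point z1, all of whose coordinates are at
    distance rho/2 from those of z0, dominates the series on the smaller polysquare. *)
Lemma analytic_locally_mpoly F z0 : analytic_at F z0 -> locally_mpoly F z0.
Proof.
move=> [c [rho [rho0 H]]].
exists (rho / 4); first lra.
have near_bd z : near_by (rho / 4) z0 z -> forall j, cabs ((z - z0) 0 j) <= rho / 2.
  by move=> zz j; have := csquare_cabs (zz j); rewrite !mxE; lra.
pose z1 : 'rV[R[i]]_n := z0 + const_mx (rho / 2)%:C.
have z1E j : cabs ((z1 - z0) 0 j) = rho / 2.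
  rewrite /z1 addrAC subrr add0r mxE cabs_real ger0_norm//; lra.
pose a (alpha : {ffun 'I_n -> nat}) := cabs (c alpha * cmonomial alpha (z1 - z0)).
have a0 alpha : 0 <= a alpha by exact: cabs_ge0.
pose T N := \sum_(alpha <- cube N) a alpha.
have [Sfin _] : (\esum_(alpha in [set: {ffun 'I_n -> nat}]) (a alpha)%:E < +oo)%E /\ True.
  split => //.
  have /H[+ _] : forall i, `|z1 0 i - z0 0 i| < rho%:C.
    by move=> i; rewrite cabsE ltcR; have := z1E i; rewrite !mxE => ->; lra.
  exact.
set S := esum _ _ in Sfin.
have S0 : (0 <= S)%E by apply: esum_ge0 => alpha _; rewrite lee_fin.
have TS N : T N <= fine S.
  rewrite -lee_fin fineK; last by rewrite ge0_fin_numE.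
  apply: esum_ge; exists [set` cube N].
    by split=> //; exact: finite_seq.
  by rewrite -fsbig_seq ?cube_uniq//= /T -sumEFin.
have supT : has_sup (range T).
  by split; [exists (T 0%N), 0%N|exists (fine S) => _ [N _ <-]].
move=> e e0.
have [_ [N _ <-] TN] := sup_adherent e0 supT.
exists (fun z => \sum_(alpha <- cube N) c alpha * cmonomial alpha (z - z0)).
  by apply: polyfun_sum => al; apply: polyfun_mul; [exact: polyfun_cst|exact: polyfun_cmonomial].
move=> z zz; rewrite -cube_sumE.
have [|_ /cvg_cabs cv] := H z.
  move=> j; rewrite cabsE ltcR; have := near_bd _ zz j; rewrite !mxE; lra.
(* N is already fixed independently of z. Convergence at z only provides an M depending on z and on
   the slack d, while the terms between N and M are dominated by the tail at z1, at most e. *)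
apply/ler_addgt0Pr => d d0.
have [M [NM MF]] : exists M, (N <= M)%N /\ cabs (F z - cube_sum c (z - z0) M) <= d.
  have [M0 _ HM] := cv _ d0.
  exists (maxn N M0); split; first exact: leq_maxl.
  by apply: HM; rewrite /= leq_maxr.
have -> : F z - cube_sum c (z - z0) N = (cube_sum c (z - z0) M - cube_sum c (z - z0) N) +
  (F z - cube_sum c (z - z0) M) by ring.
apply: le_trans (cabsD _ _) _; apply: lerD => //.
rewrite !cube_sumE (cube_sumD _ NM) addrAC subrr add0r.
apply: le_trans (cabs_sum _ _ _) _.
have : T M - T N <= e.
  have : T M <= sup (range T) by apply: ub_le_sup; [case: supT|exists M].
  lra.
rewrite /T (cube_sumD _ NM) addrAC subrr add0r; apply: le_trans.
apply: ler_sum => al _; rewrite /a !cabsM ler_wpM2l ?cabs_ge0//.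
apply: cabs_cmonomial_le => j; rewrite z1E; exact: near_bd.
Qed.

End SeveralVariables.

(** * Real partial derivatives of series *)

Section RealPartials.
Context {R : realType} {n : nat}.
Implicit Types (u f : 'rV[R]_n -> R) (x y v : 'rV[R]_n) (i j : 'I_n).

Lemma is_deriveP_eps u x v (b : R) :
  (forall e : R, 0 < e -> exists2 d, 0 < d & forall h : R, h != 0 -> `|h| <= d ->
     `|u (x + h *: v) - u x - b * h| <= e * `|h|) ->
  is_derive x v u b.
Proof.
move=> H.
have C : (fun h : R => h^-1 *: ((u \o shift x) (h *: v) - u x)) @ 0^' --> b.
  apply/cvgrPdist_le => e e0; have [d d0 Hd] := H e e0.
  near=> h.
  have h0 : h != 0 by near: h; exact: nbhs_dnbhs_neq.
  have hd : `|h| <= d.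
    near: h; apply: dnbhs0_le => //.
  rewrite /= distrC; have := Hd h h0 hd.
  rewrite -ler_pdivrMr ?normr_gt0// -normrV ?unitfE// -normrM.
  set A := _ - u x; rewrite mulrBl mulfK//; congr (_ <= _).
  by rewrite [h^-1 *: _]mulrC /A [_ *: v + x]addrC.
split; first by apply/cvg_ex; exists b.
by rewrite /derive; apply: cvg_lim C.
Unshelve. all: by end_near.
Qed.

Lemma derivable_eps u x v : derivable u x v ->
  forall e : R, 0 < e -> exists2 d, 0 < d & forall h : R, h != 0 -> `|h| <= d ->
     `|u (x + h *: v) - u x - 'D_v u x * h| <= e * `|h|.
Proof.
move=> /cvgrPdist_le H e e0.
have [d /= d0 Hd] := H e e0.
exists (d / 2); first by rewrite divr_gt0.
move=> h h0 hd.
have : ball_ [eta Num.Def.normr] 0 d h by rewrite /= sub0r normrN; lra.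
move=> /Hd /(_ h0); rewrite distrC -/('D_v u x) => Hh.
rewrite -ler_pdivrMr ?normr_gt0// -normrV ?unitfE// -normrM mulrBl mulfK//.
move: Hh; congr (`|_| <= _); rewrite /=; congr (_ - _).
by rewrite mulrC [h *: v + x]addrC.
Qed.

Lemma is_derive_line u x v (t : R) : derivable u (x + t *: v) v ->
  is_derive t 1 (fun s : R => u (x + s *: v)) ('D_v u (x + t *: v)).
Proof.
move=> /derivable_eps H.
have C : (fun h : R => h^-1 *: (((fun s : R => u (x + s *: v)) \o shift t) (h *: (1:R)) -
    u (x + t *: v))) @ 0^' --> 'D_v u (x + t *: v).
  apply/cvgrPdist_le => e e0; have [d d0 Hd] := H e e0.
  near=> h.
  have h0 : h != 0 by near: h; exact: nbhs_dnbhs_neq.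
  have hd : `|h| <= d.
    near: h; apply: dnbhs0_le => //.
  rewrite /= distrC; have := Hd h h0 hd.
  rewrite -ler_pdivrMr ?normr_gt0// -normrV ?unitfE// -normrM.
  set A := _ - u _; rewrite mulrBl mulfK//; congr (_ <= _).
  rewrite [h^-1 *: _]mulrC /A; congr (`|_ * _ - _|); congr (u _ - _).
  by rewrite [h *: 1]mulr1 scalerDl addrAC addrA.
split; first by apply/cvg_ex; exists ('D_v u (x + t *: v)).
by rewrite /derive; apply: cvg_lim C.
Unshelve. all: by end_near.
Qed.

Lemma partial_bound_line i u (B : R) x (t : R) :
  (forall y, derivable u y (delta_mx 0 i)) ->
  (forall y, `|partial i u y| <= B) ->
  `|u (x + t *: delta_mx 0 i) - u x| <= B * `|t|.
Proof.
move=> ud uB.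
pose p s := u (x + s *: delta_mx 0 i).
pose dp s := partial i u (x + s *: delta_mx 0 i).
have pd s : is_derive s (1:R) p (dp s) by apply: is_derive_line.
have pc a b : {within `[a, b], continuous p}.
  apply: continuous_subspaceT => s.
  apply: differentiable_continuous; apply/derivable1_diffP; by case: (pd s).
have -> : u x = p 0 by rewrite /p scale0r addr0.
rewrite -/(p t).
have [t0|t0] := lerP 0 t.
  have [c _ ->] := MVT_segment t0 (fun s _ => pd s) (pc 0 t).
  by rewrite subr0 normrM ler_wpM2r//; exact: uB.
have [c _] := MVT_segment (ltW t0) (fun s _ => pd s) (pc t 0).
rewrite distrC => ->.
by rewrite sub0r normrM normrN ler_wpM2r//; exact: uB.
Qed.

Lemma coord_le_norm x i : `|x 0 i| <= `|x|.
Proof.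
by rewrite [leRHS]/Num.norm /= mx_normrE; apply: (@le_bigmax_cond _ _ _ _ (0, i)).
Qed.

Lemma partial_bound_lipschitz u (B : R) x y :
  (forall i z, derivable u z (delta_mx 0 i)) ->
  (forall i z, `|partial i u z| <= B) ->
  `|u x - u y| <= n%:R * B * `|x - y|.
Proof.
move=> ud uB.
(* A path from y to x that changes one coordinate at a time; each of its n steps has length at most
   the sup norm of x - y. *)
pose w m : 'rV[R]_n := \row_j (if (j < m)%N then x 0 j else y 0 j).
have w0 : w 0%N = y by apply/rowP => j; rewrite mxE.
have wn : w n = x by apply/rowP => j; rewrite mxE ltn_ord.
have step m : (m <= n)%N -> `|u (w m) - u y| <= m%:R * B * `|x - y|.
  elim: m => [_|m IH mn]; first by rewrite w0 subrr normr0 !mul0r.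
  pose i := Ordinal mn.
  have wS : w m.+1 = w m + (x 0 i - y 0 i) *: delta_mx 0 i.
    apply/rowP => j; rewrite !mxE eqxx /= ltnS leq_eqVlt.
    have [->|ji] := eqVneq j i; first by rewrite eqxx ltnn /= mulr1 addrC subrK.
    have -> : (j == m :> nat) = false.
      by apply/negbTE; apply: contra ji => /eqP jm; apply/eqP/val_inj.
    by rewrite mulr0 addr0.
  have := IH (ltnW mn).
  have := @partial_bound_line i u B (w m) (x 0 i - y 0 i) (ud i) (uB i).
  rewrite -wS => A1 A2.
  have B0 : 0 <= B by apply: le_trans (uB i x); exact: normr_ge0.
  have : B * `|x 0 i - y 0 i| <= B * `|x - y|.
    by rewrite ler_wpM2l//; have := coord_le_norm (x - y) i; rewrite !mxE.
  have := ler_normD (u (w m.+1) - u (w m)) (u (w m) - u y); rewrite subrKA.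
  rewrite -natr1; lra.
by have := step n (leqnn n); rewrite wn.
Qed.

Lemma le_of_cvg (a b : R) (s : nat -> R) :
  s N @[N --> \oo] --> (0:R) -> (forall N, a <= b + s N) -> a <= b.
Proof.
move=> s0 H; apply/ler_addgt0Pr => e e0.
have /cvgrPdist_le /(_ e e0)[N _ /(_ N (leqnn N))] := s0.
rewrite sub0r normrN => se; have := H N; have := ler_norm (s N); lra.
Qed.

(** The mean value theorem for U_N - U_M, followed by M -> oo, shows that U_N - u is Lipschitz with
    constant d_N along the axis. This error is proportional to |h|, so it survives division by h,
    and no continuity of the derivatives is required. *)
Lemma termwise_partial i (U : nat -> 'rV[R]_n -> R) u (p : 'rV[R]_n -> R) (d : nat -> R) :
  d N @[N --> \oo] --> (0:R) ->
  (forall N y, derivable (U N) y (delta_mx 0 i)) ->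
  (forall N y, `|U N y - u y| <= d N) ->
  (forall N y, `|partial i (U N) y - p y| <= d N) ->
  forall x, is_derive x (delta_mx 0 i) u (p x).
Proof.
move=> d0 Ud Uu Up x; set v := delta_mx 0 i.
have L N y (h : R) : `|(U N (y + h *: v) - u (y + h *: v)) - (U N y - u y)| <= d N * `|h|.
  apply: (@le_of_cvg _ _ (fun M => d M * `|h| + 2 * d M)).
    rewrite -[0](_ : 0 * `|h| + 2 * 0 = 0); last by rewrite mul0r mulr0 addr0.
    by apply: cvgD; apply: cvgM => //; exact: cvg_cst.
  move=> M.
  have dM y' : derivable (U N \- U M) y' v by apply: derivableB; exact: Ud.
  have := @partial_bound_line i (U N \- U M) (d N + d M) y h dM.
  have bM y' : `|partial i (U N \- U M) y'| <= d N + d M.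
    rewrite /partial deriveB//; apply: le_trans (ler_distD (p y') _ _) _.
    by rewrite [`|p y' - _|]distrC; apply: lerD; [exact: (Up N)|exact: (Up M)].
  move=> /(_ bM); have := Uu M (y + h *: v); have := Uu M y.
  rewrite -/v /=; move: (d N) (d M) (U N _) (U N _) (U M _) (U M _) (u _) (u _) `|h|.
  move=> a b A B C D E F k; rewrite !ler_norml => /andP[? ?] /andP[? ?] /andP[? ?].
  by apply/andP; split; lra.
apply: is_deriveP_eps => e e0.
have e3 : 0 < e / 3 by lra.
have /cvgrPdist_le /(_ _ e3)[N _ /(_ N (leqnn N))] := d0.
rewrite sub0r normrN => de.
have [r r0 Hr] := derivable_eps (Ud N x) e3.
exists r => // h h0 hr.
have := Hr h h0 hr; have := L N x h; have := Up N x; rewrite -/v -/(partial i (U N) x).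
have k0 := normr_ge0 h; have dN := ler_norm (d N).
move=> A1 A2 A3.
have {}A2 : `|(U N (x + h *: v) - u (x + h *: v)) - (U N x - u x)| <= e / 3 * `|h|.
  by apply: le_trans A2 _; rewrite ler_wpM2r//; lra.
have {}A1 : `|(partial i (U N) x - p x) * h| <= e / 3 * `|h|.
  by rewrite normrM ler_wpM2r//; lra.
move: A1 A2 A3; rewrite /partial -/v; move: ('D_v _ _) (U N _) (U N _) (u _) (u _) => A B C D E.
rewrite !ler_norml => /andP[? ?] /andP[? ?] /andP[? ?].
by apply/andP; split; lra.
Qed.

Lemma is_derive_Re (G : 'rV[R[i]]_n -> R[i]) i x : locally_mpoly G (cvect x) ->
  is_derive x (delta_mx 0 i) (fun y => complex.Re (G (cvect y)))
    (complex.Re (cpartial i G (cvect x))).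
Proof.
move=> /(cpartialP i)[K [d [d0 H]]].
apply: is_deriveP_eps => e e0.
have K0 := normr_ge0 K; have KK := ler_norm K.
have e'0 : 0 < e / (`|K| + 1) by rewrite divr_gt0//; lra.
exists (Num.min d (e / (`|K| + 1))); first by rewrite lt_min d0.
move=> h h0; rewrite le_min => /andP[hd].
rewrite ler_pdivlMr; last lra.
move=> he.
have /H : cabs h%:C <= d by rewrite cabs_real.
rewrite cabs_real add0r /slice scale0r addr0.
have -> : cvect x + h%:C *: delta_mx 0 i = cvect (x + h *: delta_mx 0 i).
  apply/rowP => j; rewrite !mxE rmorphD rmorphM; congr (_ + _ * _).
  by case: (_ && _).
set D := _ - _ - _ => HD.
have -> : complex.Re (G (cvect (x + h *: delta_mx 0 i))) - complex.Re (G (cvect x)) -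
    complex.Re (cpartial i G (cvect x)) * h = complex.Re D.
  rewrite /D; case: (G _) => ? ?; case: (G _) => ? ?; case: (cpartial _ _ _) => ? ? /=.
  by rewrite mulr0 subr0.
apply: le_trans (cabs_Re _) _; apply: le_trans HD _.
rewrite expr2 mulrA ler_wpM2r//; have := normr_ge0 h; nra.
Qed.

(** * Iterated derivatives on strips *)

Definition iter_cpartial (s : seq 'I_n) G : 'rV[R[i]]_n -> R[i] := foldr cpartial G s.

Lemma locally_mpoly_iter s (G : 'rV[R[i]]_n -> R[i]) z :
  locally_mpoly G z -> locally_mpoly (iter_cpartial s G) z.
Proof. by elim: s => //= i s IH /IH; exact: locally_mpoly_cpartial. Qed.

Lemma iter_partial_Re s (G : 'rV[R[i]]_n -> R[i]) :
  (forall x, locally_mpoly G (cvect x)) ->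
  iter_partial s (fun y => complex.Re (G (cvect y))) =
  (fun y => complex.Re (iter_cpartial s G (cvect y))).
Proof.
move=> GL; elim: s => //= i s ->; apply/funext => x.
rewrite /partial; apply: derive_val; apply: is_derive_Re.
exact: locally_mpoly_iter.
Qed.

Lemma stripP (r : R) (z : 'rV[R[i]]_n) : 0 <= r ->
  strip r z <-> forall j, `|complex.Im (z 0 j)| <= r.
Proof.
move=> r0; split.
  move=> H j; apply: le_trans H; have := coord_le_norm (map_mx (@complex.Im R) z) j.
  by rewrite mxE.
move=> H; rewrite /strip /= [leLHS]/Num.norm /= mx_normrE.
apply: bigmax_le => // -[a j] _ /=; rewrite mxE (ord1 a); exact: H.
Qed.

(** Each differentiation applies Cauchy's estimate on a square of radius h, at the price of a width
    h of the strip and a factor 2/h. *)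
Lemma iter_cpartial_bound s (G : 'rV[R[i]]_n -> R[i]) (r h M : R) : 0 < h ->
  (forall z, strip r z -> locally_mpoly G z) ->
  (forall z, strip r z -> cabs (G z) <= M) ->
  (size s)%:R * h <= r ->
  forall z, strip (r - (size s)%:R * h) z ->
    cabs (iter_cpartial s G z) <= M * (2 / h) ^+ size s.
Proof.
move=> h0 GL GM; elim: s => [_ z|i s IH].
  by rewrite mul0r subr0 expr0 mulr1; exact: GM.
rewrite /= -natr1 mulrDl mul1r => sr z.
have s0 : 0 <= (size s)%:R * h by rewrite mulr_ge0// ltW.
have [r1 r2] : 0 <= r - ((size s)%:R * h + h) /\ 0 <= r - (size s)%:R * h by split; lra.
move=> /stripP => /(_ r1) zr.
have sq w : csquare h w -> strip (r - (size s)%:R * h) (z + w *: delta_mx 0 i).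
  move=> [_ wh]; apply/stripP => // j; rewrite slice_coord.
  have := zr j; have : `|complex.Im (w * (j == i)%:R)| <= h.
    by case: (j == i); rewrite ?mulr1 ?mulr0//= normr0 ltW.
  case: (z 0 j) (w * _) => ? ? [? ?] /= ? ?; apply: le_trans (ler_normD _ _) _; lra.
have -> : M * (2 / h) ^+ (size s).+1 = 2 * (M * (2 / h) ^+ size s) / h by rewrite exprS; ring.
apply: cpartial_bound => // w wh.
  apply: locally_mpoly_iter; apply: GL; have := sq w wh.
  move=> /stripP => /(_ r2) H; apply/stripP; first lra.
  by move=> j; apply: le_trans (H j) _; lra.
by apply: IH; [lra|exact: sq].
Qed.

Lemma strip_cvect (r : R) x : 0 <= r -> strip r (cvect x).
Proof. by move=> r0; apply/stripP => // j; rewrite mxE /= normr0. Qed.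

Lemma iter_partial_Re_bound s (G : 'rV[R[i]]_n -> R[i]) (r M : R) (k : nat) x : 0 < r ->
  (forall z, strip r z -> locally_mpoly G z) ->
  (forall z, strip r z -> cabs (G z) <= M) -> (size s <= k.+1)%N ->
  `|iter_partial s (fun y => complex.Re (G (cvect y))) x| <=
     M * (2 * k.+1%:R / r) ^+ size s.
Proof.
move=> r0 GL GM sk.
have k0 : 0 < k.+1%:R :> R by rewrite ltr0n.
rewrite iter_partial_Re; last by move=> y; apply: GL; apply: strip_cvect; exact: ltW.
apply: le_trans (cabs_Re _) _.
(* With this h the strip affords k + 1 differentiations: k for the derivatives themselves and one
   for their increments. *)
have h0 : 0 < r / k.+1%:R by rewrite divr_gt0.
have sr : (size s)%:R * (r / k.+1%:R) <= r.
  by rewrite mulrA ler_pdivrMr// [r * _]mulrC ler_wpM2r ?ler_nat// ltW.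
have -> : 2 * k.+1%:R / r = 2 / (r / k.+1%:R) by field; rewrite !gt_eqF.
by apply: (iter_cpartial_bound h0 GL GM sr); apply: strip_cvect; rewrite subr_ge0.
Qed.

(** * Termwise differentiation of dominated series *)

Section Series.
Variables (k : nat) (g : nat -> 'rV[R]_n -> R) (f : 'rV[R]_n -> R) (b : nat -> R) (B : R).
Hypothesis g_derivable : forall s, (size s <= k)%N -> forall m i x,
  derivable (iter_partial s (g m)) x (delta_mx 0 i).
Hypothesis g_bound : forall s, (size s <= k)%N -> forall m x,
  `|iter_partial s (g m) x| <= b m.
Hypothesis b_bound : forall N, \sum_(m < N) b m <= B.
Hypothesis f_sum : forall x, (fun N => \sum_(m < N) g m x) @ \oo --> f x.

Let b_sum N := \sum_(m < N) b m.
Let b_tot : R := sup (range b_sum).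
Let tail N : R := b_tot - b_sum N.

Let b_ge0 m : 0 <= b m.
Proof. exact: le_trans (normr_ge0 _) (g_bound (leq0n k : (size [::] <= k)%N) m 0). Qed.

Let b_sum_mono N M : (N <= M)%N -> b_sum N <= b_sum M.
Proof.
elim: M => [|M IH]; first by rewrite leqn0 => /eqP ->.
rewrite leq_eqVlt => /predU1P[->//|/IH]; move/le_trans; apply.
by rewrite /b_sum big_ord_recr /= lerDl.
Qed.

Let has_sup_b : has_sup (range b_sum).
Proof. by split; [exists (b_sum 0), 0%N|exists B => _ [N _ <-]; exact: b_bound]. Qed.

Let b_sum_le N : b_sum N <= b_tot.
Proof. by apply: ub_le_sup; [case: has_sup_b|exists N]. Qed.

Let tail_ge0 N : 0 <= tail N.
Proof. by rewrite subr_ge0 b_sum_le. Qed.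

Let tail_cvg : tail N @[N --> \oo] --> (0:R).
Proof.
apply/cvgrPdist_le => e e0.
have [_ [N _ <-] HN] := sup_adherent e0 has_sup_b.
exists N => // M /= NM; rewrite sub0r normrN ger0_norm// /tail.
by have := b_sum_mono NM; rewrite -/b_tot in HN; lra.
Qed.

Let psum s N x := \sum_(m < N) iter_partial s (g m) x.

Let psum_dist s x : (size s <= k)%N -> forall N M,
  `|psum s N x - psum s M x| <= tail N + tail M.
Proof.
move=> sk; suff H N M : (N <= M)%N -> `|psum s M x - psum s N x| <= b_sum M - b_sum N.
  move=> N M; have := b_sum_le N; have := b_sum_le M; rewrite /tail.
  by case: (leqP N M) => [/H|/ltnW/H]; rewrite 1?distrC; lra.
elim: M => [|M IH]; first by rewrite leqn0 => /eqP ->; rewrite !subrr normr0.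
rewrite leq_eqVlt => /predU1P[->|/IH]; first by rewrite !subrr normr0.
rewrite /psum /b_sum !big_ord_recr /= -/(psum s M x) -/(psum s N x) -/(b_sum M) -/(b_sum N).
have := g_bound sk M x; have := ler_normD (psum s M x - psum s N x) (iter_partial s (g M) x).
have -> : psum s M x + iter_partial s (g M) x - psum s N x =
  psum s M x - psum s N x + iter_partial s (g M) x by ring.
lra.
Qed.

Let psum_derive s i x N : (size s <= k)%N ->
  is_derive x (delta_mx 0 i) (psum s N) (psum (i :: s) N x).
Proof.
move=> sk; elim: N => [|N IH].
  rewrite /psum big_ord0; under eq_fun do rewrite big_ord0; exact: is_derive_cst.
rewrite /psum big_ord_recr /=; under eq_fun do rewrite big_ord_recr /=.
apply: is_deriveD.
by apply: DeriveDef => //; exact: g_derivable.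
Qed.

(** By induction on the order: the differentiated partial sums are Cauchy, and [termwise_partial]
    identifies their limit with the derivative of the limit found one order below. *)
Let psum_limit s : (size s <= k)%N -> forall x N, `|psum s N x - iter_partial s f x| <= tail N.
Proof.
elim: s => [_ x N|i s IH sk].
  apply: (@le_of_cvg _ _ (fun M => tail M + `|psum [::] M x - f x|)).
    rewrite -[0]addr0; apply: cvgD => //; rewrite -[0](normr0 R); apply: cvg_norm.
    by rewrite -(subrr (f x)); apply: cvgB; [exact: f_sum|exact: cvg_cst].
  move=> M; have := psum_dist x (leq0n k : (size [::] <= k)%N) N M.
  have := ler_normD (psum [::] N x - psum [::] M x) (psum [::] M x - f x).
  by rewrite subrKA /=; lra.
have /choice[p pP] : forall x, exists l, forall N, `|psum (i :: s) N x - l| <= tail N.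
  by move=> x; apply: (real_family_limit 0%N); exact: psum_dist.
have sk' := ltnW sk.
have D x : is_derive x (delta_mx 0 i) (iter_partial s f) (p x).
  apply: (@termwise_partial i (psum s) _ p tail) => //.
  - by move=> N y; case: (psum_derive i y N sk').
  - by move=> N y; exact: IH.
  - move=> N y; rewrite /partial; case: (psum_derive i y N sk') => _ ->; exact: pP.
by move=> x N; rewrite /= /partial; case: (D x) => _ ->; exact: pP.
Qed.

Lemma series_derivable s i x : (size s < k)%N ->
  derivable (iter_partial s f) x (delta_mx 0 i).
Proof.
move=> sk; have sk' := ltnW sk.
suff [] : is_derive x (delta_mx 0 i) (iter_partial s f) (iter_partial (i :: s) f x) by [].
apply: (@termwise_partial i (psum s) _ (iter_partial (i :: s) f) tail) => //.
- by move=> N y; case: (psum_derive i y N sk').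
- by move=> N y; exact: psum_limit.
- move=> N y; rewrite /partial; case: (psum_derive i y N sk') => _ ->.
  exact: (psum_limit (s := i :: s) sk).
Qed.

Lemma series_bound s x : (size s <= k)%N -> `|iter_partial s f x| <= B.
Proof.
move=> sk; have := psum_limit sk x 0; rewrite /psum big_ord0 sub0r normrN.
move/le_trans; apply; rewrite /tail /b_sum big_ord0 subr0.
apply: ge_sup; first by case: has_sup_b.
by move=> _ [N _ <-]; exact: b_bound.
Qed.

Lemma series_modulus s x y (c : nat -> R) (C : R) : (size s <= k)%N ->
  (forall m, `|iter_partial s (g m) x - iter_partial s (g m) y| <= c m) ->
  (forall N, \sum_(m < N) c m <= C) ->
  `|iter_partial s f x - iter_partial s f y| <= C.
Proof.
move=> sk gc cC; apply: (@le_of_cvg _ _ (fun N => 2 * tail N)).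
  by rewrite -[0](mulr0 2); apply: cvgM => //; exact: cvg_cst.
move=> N; have := psum_limit sk x N; have := psum_limit sk y N.
have : `|psum s N x - psum s N y| <= C.
  apply: le_trans (cC N); rewrite /psum -sumrB; apply: le_trans (ler_norm_sum _ _ _) _.
  by apply: ler_sum => m _; exact: gc.
move: (psum _ _ _) (psum _ _ _) (iter_partial _ _ _) (iter_partial _ _ _) => a1 a2 a3 a4.
by rewrite !ler_norml => /andP[? ?] /andP[? ?] /andP[? ?]; apply/andP; split; lra.
Qed.

End Series.
End RealPartials.

(** * The integrals of the rates *)

Section RateIntegrals.
Context {R : realType}.
Variables (a : R) (phi : R -> R).
Hypothesis a_gt0 : 0 < a.
Hypothesis phi_nondecreasing : {in `[0, a] &, {homo phi : x y / x <= y}}.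
Hypothesis phi_continuous : {within `[0, a], continuous phi}.
Hypothesis phi0 : phi 0 = 0.

Let mu := (@lebesgue_measure R).

Let phi_le x y : 0 <= x -> x <= y -> y <= a -> phi x <= phi y.
Proof.
move=> x0 xy ya; apply: phi_nondecreasing => //; rewrite in_itv /= ?x0 ?ya ?andbT /=;
  [exact: le_trans ya|exact: le_trans xy].
Qed.

Let phi_ge0 x : 0 <= x -> x <= a -> 0 <= phi x.
Proof. by move=> x0 xa; rewrite -phi0 phi_le. Qed.

Lemma measurable_phi_div m : measurable_fun `]0, a] (fun t => phi t / t ^+ m).
Proof.
apply: measurable_funM.
  apply: (@measurable_funS _ _ _ _ `[0, a]) => //.
    by apply: subset_itvr; rewrite bnd_simp.
  by apply: subspace_continuous_measurable_fun.
apply: subspace_continuous_measurable_fun => //.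
apply: continuous_in_subspaceT => x; rewrite inE /= in_itv /= => /andP[x0 _].
by apply: cvgV; [rewrite expf_neq0// gt_eqF|exact: exprn_continuous].
Qed.

Let sub_itv x y : 0 < x -> y <= a -> (`[x, y] `<=` `]0, a])%classic.
Proof.
move=> x0 ya t; rewrite /= !in_itv /= => /andP[xt ty].
by rewrite (lt_le_trans x0 xt) (le_trans ty ya).
Qed.

Let phi_div_bounds m x y t : 0 < x -> y <= a -> x <= t -> t <= y ->
  phi x / y ^+ m <= phi t / t ^+ m <= phi y / x ^+ m.
Proof.
move=> x0 ya xt ty.
have t0 : 0 < t by exact: lt_le_trans xt.
have y0 : 0 < y by exact: lt_le_trans ty.
have px : 0 <= phi x by apply: phi_ge0; [exact: ltW|lra].
apply/andP; split; apply: ler_pM; rewrite ?invr_ge0 ?exprn_ge0 ?(ltW t0) ?(ltW y0)//.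
- apply: phi_le; lra.
- by rewrite lef_pV2 ?posrE ?exprn_gt0// lerXn2r// nnegrE ltW.
- apply: phi_ge0; lra.
- apply: phi_le; lra.
- by rewrite lef_pV2 ?posrE ?exprn_gt0// lerXn2r// nnegrE ltW.
Qed.

Lemma integrable_phi_div m x y : 0 < x -> y <= a ->
  mu.-integrable `[x, y] (EFin \o (fun t => phi t / t ^+ m)).
Proof.
move=> x0 ya; apply: measurable_bounded_integrable => //.
- have := lebesgue_measure_itv `[x, y]; rewrite /= /mu => ->.
  by case: ifP => // _; rewrite -EFinB ltry.
- by apply: measurable_funS (measurable_phi_div m) => //; exact: sub_itv.
exists (phi y / x ^+ m); split; first by rewrite num_real.
move=> M hM t /=; rewrite in_itv /= => /andP[xt ty]; apply: le_trans (ltW hM).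
have /andP[_ h] := phi_div_bounds m x0 ya xt ty.
rewrite ger0_norm// divr_ge0 ?exprn_ge0 ?phi_ge0//; lra.
Qed.

Lemma phi_div_integral_bounds m x y : 0 < x -> x <= y -> y <= a ->
  (y - x) * (phi x / y ^+ m) <= \int[mu]_(t in `]x, y]) (phi t / t ^+ m)
    <= (y - x) * (phi y / x ^+ m).
Proof.
move=> x0 xy ya.
have I : mu.-integrable `]x, y] (EFin \o (fun t => phi t / t ^+ m)).
  apply: integrableS (integrable_phi_div m x0 ya) => //.
  by apply: subset_itvr; rewrite bnd_simp.
have mE : fine (mu `]x, y]) = y - x.
  have := lebesgue_measure_itv `]x, y]; rewrite /= /mu => ->.
  rewrite lte_fin; case: (ltrP x y) => //= yx; lra.
have C (c : R) : mu.-integrable `]x, y] (EFin \o (fun=> c)).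
  apply: measurable_bounded_integrable => //; last first.
    by exists `|c|; split; [rewrite num_real|move=> M hM t _; exact: ltW].
  have := lebesgue_measure_itv `]x, y]; rewrite /= /mu => ->.
  by case: ifP => // _; rewrite -EFinB ltry.
have E c : (y - x) * c = \int[mu]_(t in `]x, y]) c by rewrite Rintegral_cst// mE mulrC.
rewrite !E; apply/andP; split; apply: le_Rintegral => // t;
  rewrite /= in_itv /= => /andP[/ltW xt ty];
  by have /andP[] := phi_div_bounds m x0 ya xt ty.
Qed.

Lemma integral_left_sub m x y z : 0 < x -> x <= y -> y <= z -> z <= a ->
  \int[mu]_(t in `[x, z]) (phi t / t ^+ m) - \int[mu]_(t in `[y, z]) (phi t / t ^+ m) =
  \int[mu]_(t in `]x, y]) (phi t / t ^+ m).
Proof.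
move=> x0 xy yz za.
have y0 : 0 < y by exact: lt_le_trans xy.
have := @Rintegral_itvB R (fun t => phi t / t ^+ m) (BLeft x) (BRight z) y.
rewrite !bnd_simp => /(_ (integrable_phi_div m x0 za) xy yz).
rewrite (Rintegral_itv_obnd_cbnd (b := BRight z)); last first.
  apply: integrableS (integrable_phi_div m y0 za) => //.
  by apply: subset_itvr; rewrite bnd_simp.
rewrite (Rintegral_itv_obnd_cbnd (b := BRight y)); last first.
  apply: integrableS (integrable_phi_div m x0 (le_trans yz za)) => //.
  by apply: subset_itvr; rewrite bnd_simp.
by move=> <-; rewrite /mu; ring.
Qed.

Section Convergent.
Variable m : nat.
Hypothesis a_ge1 : 1 <= a.
Hypothesis int_cvg : (\int[mu]_(x in `]0%R, 1%R]) (phi x / x ^+ m)%:E < +oo)%E.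

(** Finiteness is assumed on (0, 1] while z may exceed 1; on [1, a] the integrand is bounded. *)
Lemma integrable_phi_div0 z : z <= a ->
  mu.-integrable `]0, z] (EFin \o (fun t => phi t / t ^+ m)).
Proof.
move=> za.
suff I : mu.-integrable `]0, a] (EFin \o (fun t => phi t / t ^+ m)).
  by apply: integrableS I => //; apply: subset_itvl; rewrite bnd_simp.
apply/integrableP; split.
  by apply/measurable_EFinP; exact: measurable_phi_div.
have nn t : `]0, a]%classic t -> `|(phi t / t ^+ m)%:E|%E = (phi t / t ^+ m)%:E.
  rewrite /= in_itv /= => /andP[t0 ta].
  by rewrite /= ger0_norm// divr_ge0 ?exprn_ge0 ?phi_ge0// ltW.
have nnI b : (`]b, a] `<=` `]0, a])%classic ->
    (\int[mu]_(x in `]b, a]) `|(EFin \o (fun t => (phi t / t ^+ m)%R)) x| =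
     \int[mu]_(x in `]b, a]) (phi x / x ^+ m)%:E)%E.
  by move=> ba; apply: eq_integral => t /set_mem /ba /nn.
rewrite nnI//.
have E : (`]0, a] = `]0%R, 1%R] `|` `]1%R, a])%classic.
  by rewrite -(@itv_bndbnd_setU _ _ (BRight 0) (BRight 1))// bnd_simp.
rewrite E ge0_integral_setU//; last 3 first.
- by rewrite -E; apply/measurable_EFinP; exact: measurable_phi_div.
- move=> t; rewrite -E => tE; rewrite -(nn t tE); exact: abse_ge0.
- by apply/disj_setPS => t [] /=; rewrite !in_itv /=; lra.
apply: lte_add_pinfty => //.
have sub : (`]1, a] `<=` `[1, a])%classic by apply: subset_itvr; rewrite bnd_simp.
have /integrableP[_] : mu.-integrable `]1, a] (EFin \o (fun t => phi t / t ^+ m)).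
  by apply: integrableS (integrable_phi_div m ltr01 (lexx a)).
by rewrite nnI// => t tE; rewrite E; right.
Qed.

Lemma integral_right_sub x y : 0 < x -> x <= y -> y <= a ->
  \int[mu]_(t in `]0, y]) (phi t / t ^+ m) - \int[mu]_(t in `]0, x]) (phi t / t ^+ m) =
  \int[mu]_(t in `]x, y]) (phi t / t ^+ m).
Proof.
move=> x0 xy ya.
by apply: (@Rintegral_itvB R _ (BRight 0) (BRight y));
  rewrite ?bnd_simp//; [exact: integrable_phi_div0|exact: ltW].
Qed.

Lemma integral_right_small (e : R) : 0 < e -> exists2 d, 0 < d &
  forall s, 0 < s -> s <= d -> \int[mu]_(t in `]0, s]) (phi t / t ^+ m) <= e.
Proof.
move=> e0.
have I : mu.-integrable setT (EFin \o ((fun t => phi t / t ^+ m) \_ `]0, a])).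
  rewrite -restrict_EFin; apply/integrable_restrict => //=; rewrite setTI.
  exact: integrable_phi_div0.
have [d [d0 H]] := integral_normr_continuous I e0.
exists (Num.min a (d / 2)); first by rewrite lt_min a_gt0 divr_gt0.
move=> s s0; rewrite le_min => /andP[sa sd].
have /H{}H : (mu `]0%R, s] < d%:E)%E.
  have := lebesgue_measure_itv `]0, s]; rewrite /= /mu => ->.
  by rewrite lte_fin s0 -EFinB lte_fin; lra.
apply: le_trans (ltW (H _)) => //.
rewrite le_eqVlt; apply/orP; left; apply/eqP; apply: eq_Rintegral => t.
rewrite inE /= in_itv /= => /andP[t0 ts]; rewrite patchE mem_set /=; last first.
  by rewrite in_itv /= t0 (le_trans ts sa).
by rewrite ger0_norm// divr_ge0 ?exprn_ge0 ?phi_ge0 ?(le_trans ts sa)// ltW.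
Qed.
End Convergent.

(** If phi(x) = 0, then phi = 0 on (0, x] by monotonicity, and the integrand is at most phi(1) / x^m
    on (0, 1], so the integral is finite. *)
Lemma divergent_phi_gt0 m : 1 <= a ->
  (\int[mu]_(x in `]0%R, 1%R]) (phi x / x ^+ m)%:E = +oo)%E ->
  forall x, 0 < x -> x <= a -> 0 < phi x.
Proof.
move=> a1 dvg x x0 xa; rewrite lt_neqAle phi_ge0 ?(ltW x0)// andbT eq_sym.
apply/eqP => px.
have : (\int[mu]_(x in `]0%R, 1%R]) (phi x / x ^+ m)%:E <=
        \int[mu]_(t in `]0%R, 1%R]) (phi 1 / x ^+ m)%:E)%E.
  have p1 : 0 <= phi 1 by apply: phi_ge0.
  apply: ge0_le_integral => //=.
  - move=> t; rewrite in_itv /= => /andP[t0 t1].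
    rewrite lee_fin divr_ge0 ?exprn_ge0 ?phi_ge0//; lra.
  - apply/measurable_EFinP; apply: measurable_funS (measurable_phi_div m) => //.
    by apply: subset_itvl; rewrite bnd_simp.
  - move=> t; rewrite in_itv /= lee_fin => /andP[t0 t1].
    have [tx|xt] := lerP t x.
      have -> : phi t = 0.
        apply/eqP; rewrite eq_le phi_ge0 ?(le_trans tx xa) ?(ltW t0)// andbT.
        by rewrite -px phi_le// ltW.
      by rewrite mul0r divr_ge0 ?exprn_ge0// ltW.
    by have /andP[] := phi_div_bounds m x0 a1 (ltW xt) t1.
rewrite dvg integral_cst//= leye_eq.
have := lebesgue_measure_itv `]0:R, 1:R]; rewrite /= /mu => ->.
by rewrite lte_fin ltr01 -EFinB -EFinM.
Qed.

End RateIntegrals.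

(** * The balanced modulus of continuity *)

Section BalancedRates.
Context {R : realType}.
Variables (k : nat) (eps : R) (phi U V : R -> R).
Hypothesis eps_gt0 : 0 < eps.
Hypothesis phi_gt0 : forall x, 0 < x -> x <= eps -> 0 < phi x.
Hypothesis phi_le : forall x y, 0 < x -> x <= y -> y <= eps -> phi x <= phi y.
(** From here on the integrals are abstract: they enter through these bounds on increments, the
    value of U at eps, and the sign and smallness of V. *)
Hypothesis V_bounds : forall x y, 0 < x -> x <= y -> y <= eps ->
  (y - x) * (phi x / y ^+ k.+1) <= V y - V x <= (y - x) * (phi y / x ^+ k.+1).
Hypothesis U_bounds : forall x y, 0 < x -> x <= y -> y <= eps ->
  (y - x) * (phi x / y ^+ k.+2) <= U x - U y <= (y - x) * (phi y / x ^+ k.+2).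
Hypothesis U_eps : U eps = 0.
Hypothesis V_ge0 : forall x, x <= eps -> 0 <= V x.
Hypothesis V_small : forall e, 0 < e -> exists2 d, 0 < d &
  forall s, 0 < s -> s <= d -> V s <= e.

Let quot_gt0 x y m : 0 < x -> x <= y -> y <= eps -> 0 < phi x / y ^+ m.
Proof.
move=> x0 xy ye; rewrite divr_gt0 ?exprn_gt0 ?(lt_le_trans x0 xy)//.
by rewrite phi_gt0// (le_trans xy).
Qed.

Let V_lt x y : 0 < x -> x < y -> y <= eps -> V x < V y.
Proof.
move=> x0 xy ye; rewrite -subr_gt0; have /andP[+ _] := V_bounds x0 (ltW xy) ye.
by apply: lt_le_trans; rewrite mulr_gt0 ?subr_gt0 ?quot_gt0// ltW.
Qed.

Let U_lt x y : 0 < x -> x < y -> y <= eps -> U y < U x.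
Proof.
move=> x0 xy ye; rewrite -subr_gt0; have /andP[+ _] := U_bounds x0 (ltW xy) ye.
by apply: lt_le_trans; rewrite mulr_gt0 ?subr_gt0 ?quot_gt0// ltW.
Qed.

Let V_le x y : 0 < x -> x <= y -> y <= eps -> V x <= V y.
Proof. by move=> x0; rewrite le_eqVlt => /predU1P[->//|xy ye]; apply/ltW/V_lt. Qed.

Let U_le x y : 0 < x -> x <= y -> y <= eps -> U y <= U x.
Proof. by move=> x0; rewrite le_eqVlt => /predU1P[->//|xy ye]; apply/ltW/U_lt. Qed.

Let V_gt0 x : 0 < x -> x <= eps -> 0 < V x.
Proof.
move=> x0 xe; have h : x / 2 <= eps by lra.
by apply: (le_lt_trans (V_ge0 h)); apply: V_lt; lra.
Qed.

Let U_ge0 x : 0 < x -> x <= eps -> 0 <= U x.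
Proof. by move=> x0 xe; rewrite -U_eps; exact: U_le. Qed.

Let lipschitz_within (f : R -> R) (x y K : R) :
  (forall u v, x <= u -> u <= v -> v <= y -> `|f u - f v| <= K * (v - u)) ->
  {within `[x, y], continuous f}.
Proof.
move=> H.
have L (u v : R) : x <= u <= y -> x <= v <= y -> `|f u - f v| <= K * `|u - v|.
  move=> /andP[xu uy] /andP[xv vy]; have [uv|vu] := lerP u v.
    exact: H.
  by rewrite distrC; apply: H => //; exact: ltW.
apply/subspace_continuousP => u; rewrite /= in_itv /= => uxy.
apply/cvgrPdist_le => e e0.
have K0 : 0 < `|K| + 1 by have := normr_ge0 K; lra.
exists (e / (`|K| + 1)); first by rewrite /= divr_gt0.
move=> v; rewrite /ball /= ltr_pdivlMr// in_itv /= => uv vxy.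
apply: le_trans (L _ _ uxy vxy) _.
by have := ler_norm K; have := normr_ge0 (u - v : R); nra.
Qed.

(** Intermediate value theorem for V - gamma U: it is nonnegative at eps, where U vanishes, and
    nonpositive close to 0, where V is small while U is at least U(eps/2) > 0. *)
Lemma balance_exists gamma : 0 < gamma ->
  exists s, [/\ 0 < s, s <= eps & V s = gamma * U s].
Proof.
move=> g0; pose D s := V s - gamma * U s.
have u0 : 0 < U (eps / 2) by rewrite -U_eps; apply: U_lt; have := eps_gt0; lra.
have [|d d0 Hd] := V_small (_ : 0 < gamma * U (eps / 2)); first by rewrite mulr_gt0.
pose s0 := Num.min d (eps / 2).
have s00 : 0 < s0 by rewrite lt_min d0 divr_gt0.
have s0d : s0 <= d by rewrite /s0 ge_min lexx.
have s0e : s0 <= eps / 2 by rewrite /s0 ge_min lexx orbT.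
have Ds0 : D s0 <= 0.
  have := Hd _ s00 s0d; have : U (eps / 2) <= U s0 by apply: U_le; have := eps_gt0; lra.
  by move=> /(ler_wpM2l (ltW g0)); rewrite /D; lra.
have se' : s0 <= eps by have := eps_gt0; lra.
have De : 0 <= D eps by rewrite /D U_eps mulr0 subr0; exact: V_ge0.
have cD : {within `[s0, eps], continuous D}.
  apply: (@lipschitz_within _ _ _ (phi eps / s0 ^+ k.+1 + gamma * (phi eps / s0 ^+ k.+2))).
  move=> u v s0u uv ve.
  have u00 : 0 < u by exact: lt_le_trans s0u.
  have Q m : phi v / u ^+ m <= phi eps / s0 ^+ m.
    apply: ler_pM; rewrite ?invr_ge0 ?exprn_ge0 ?(ltW u00)//.
    - by apply/ltW/phi_gt0 => //; exact: lt_le_trans uv.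
    - by apply: phi_le => //; exact: lt_le_trans uv.
    - by rewrite lef_pV2 ?posrE ?exprn_gt0// lerXn2r// nnegrE ltW.
  have /andP[_ V2] := V_bounds u00 uv ve; have /andP[_ U2] := U_bounds u00 uv ve.
  have uv0 : 0 <= v - u by rewrite subr_ge0.
  have V1 := V_le u00 uv ve; have U1 := U_le u00 uv ve.
  have V3 := ler_wpM2l uv0 (Q k.+1); have U3 := ler_wpM2l uv0 (Q k.+2).
  have U4 : gamma * (U u - U v) <= gamma * ((v - u) * (phi eps / s0 ^+ k.+2)).
    by rewrite ler_wpM2l ?(ltW g0)//; exact: le_trans U3.
  have U5 : 0 <= gamma * (U u - U v) by rewrite mulr_ge0 ?(ltW g0)// subr_ge0.
  rewrite distrC ger0_norm /D; lra.
have [|s] := @IVT _ D s0 eps 0 se' cD.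
  by rewrite ge_min Ds0 le_max De orbT.
rewrite in_itv /= => /andP[s0s se] Ds; exists s; split=> //.
  exact: lt_le_trans s0s.
by apply/eqP; rewrite -subr_eq0; apply/eqP.
Qed.

Lemma balance_function : exists L : R -> R, forall gamma, 0 < gamma ->
  [/\ 0 < L gamma, L gamma <= eps & V (L gamma) = gamma * U (L gamma)].
Proof.
have /choice[L LP] : forall gamma, exists s, 0 < gamma ->
    [/\ 0 < s, s <= eps & V s = gamma * U s]; last by exists L.
move=> gamma; have [g0|g0] := lerP gamma 0; first by exists 0 => ?; lra.
by have [s sP] := balance_exists g0; exists s.
Qed.

(** * The balance point as a function of gamma *)

Section Balance.
Variable L : R -> R.
Hypothesis LP : forall gamma, 0 < gamma ->
  [/\ 0 < L gamma, L gamma <= eps & V (L gamma) = gamma * U (L gamma)].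

(** If L(g2) < L(g1), then V(L(g1)) = g1 U(L(g1)) <= g2 U(L(g2)) = V(L(g2)), against the strict
    growth of V. *)
Let L_le g1 g2 : 0 < g1 -> g1 <= g2 -> L g1 <= L g2.
Proof.
move=> g10 g12; rewrite leNgt; apply/negP => L21.
have [l10 l1e E1] := LP g10; have [l20 l2e E2] := LP (lt_le_trans g10 g12).
have := V_lt l20 L21 l1e; have u21 := U_lt l20 L21 l1e; have u1 := U_ge0 l10 l1e.
rewrite E1 E2; apply/negP; rewrite -leNgt.
by apply: ler_pM => //; exact: ltW.
Qed.

Lemma balance_small d : 0 < d -> exists2 g, 0 < g &
  forall gamma, 0 < gamma -> gamma <= g -> L gamma <= d.
Proof.
move=> d0; pose c := Num.min d (eps / 2).
have c0 : 0 < c by rewrite lt_min d0 divr_gt0.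
have ce : c <= eps / 2 by rewrite /c ge_min lexx orbT.
have uc : 0 < U c by rewrite -U_eps; apply: U_lt; have := eps_gt0; lra.
have vc : 0 < V c by apply: V_gt0; have := eps_gt0; lra.
(* This is the gamma whose balance point is c; the bound c <= eps/2 makes U c positive. *)
exists (V c / U c); first by rewrite divr_gt0.
move=> g g0; rewrite ler_pdivlMr// => gU.
have [l0 le E] := LP g0.
suff : L g <= c by move/le_trans; apply; rewrite /c ge_min lexx.
rewrite leNgt; apply/negP => cL.
have := V_lt c0 cL le; have := ltW (U_lt c0 cL le).
by move=> /(ler_wpM2l (ltW g0)); rewrite E; lra.
Qed.

Let omega gamma := V (L gamma).

Lemma balance_modulus : is_modulus 1 omega.
Proof.
have om0 x : 0 < x -> 0 < omega x by move=> /LP[? ? _]; exact: V_gt0.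
have om_le x y : 0 < x -> x <= y -> omega x <= omega y.
  move=> x0 xy; have [? ? _] := LP x0; have [? ? _] := LP (lt_le_trans x0 xy).
  by apply: V_le => //; exact: L_le.
have uL x y : 0 < x -> x <= y -> U (L y) <= U (L x).
  move=> x0 xy; have [? ? _] := LP x0; have [? ? _] := LP (lt_le_trans x0 xy).
  by apply: U_le => //; exact: L_le.
have uL0 x : 0 < x -> 0 < U (L x).
  by move=> x0; have := om0 _ x0; have [_ _] := LP x0; rewrite /omega => ->; rewrite pmulr_rgt0.
(* Since omega(x) = x U(L(x)) with U(L(x)) nonincreasing, omega(y) - omega(x) <= (y - x) U(L(x)):
   omega is Lipschitz away from 0. *)
have lip c x y : 0 < c -> c <= x -> x <= y -> 0 <= omega y - omega x <= U (L c) * (y - x).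
  move=> c0 cx xy; have x0 : 0 < x by exact: lt_le_trans cx.
  rewrite subr_ge0 om_le//=.
  have [_ _] := LP x0; have [_ _] := LP (lt_le_trans x0 xy); rewrite /omega => -> ->.
  have y0 : 0 <= y by exact/ltW/(lt_le_trans x0).
  have := ler_wpM2l y0 (uL _ _ x0 xy).
  have : 0 <= y - x by rewrite subr_ge0.
  by move=> /ler_wpM2r/(_ _ _ (uL _ _ c0 cx)); lra.
split => //.
- by move=> x; rewrite in_itv /= => /andP[/om0].
- by move=> x y; rewrite !in_itv /= => /andP[x0 _] _; exact: om_le.
- apply: continuous_in_subspaceT => x; rewrite inE /= in_itv /= => /andP[x0 _].
  apply/cvgrPdist_le => e e0.
  have c0 : 0 < x / 2 by lra.
  have u0 := uL0 _ c0.
  exists (Num.min (x / 2) (e / U (L (x / 2)))) => /=.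
    by rewrite lt_min c0 divr_gt0.
  move=> y; rewrite /= lt_min [_ < e / _]ltr_pdivlMr// => /andP[xy1 xy2].
  have cy : x / 2 <= y by have := ler_norm (x - y); lra.
  have cx : x / 2 <= x by lra.
  have [xy|yx] := lerP x y.
    have := lip _ _ _ c0 cx xy; move: xy2.
    rewrite distrC ger0_norm ?subr_ge0// => ? /andP[? ?].
    by rewrite distrC ger0_norm//; lra.
  have := lip _ _ _ c0 cy (ltW yx); move: xy2.
  rewrite ger0_norm ?subr_ge0 ?(ltW yx)// => ? /andP[? ?].
  by rewrite ger0_norm//; lra.
split.
  apply/cvgrPdist_le => e e0.
  have [d d0 Vd] := V_small e0; have [g g0 Hg] := balance_small d0.
  near=> x; have x0 : 0 < x by near: x; exact: nbhs_right_gt.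
  have xg : x <= g by near: x; exact: nbhs_right_le.
  rewrite sub0r normrN ger0_norm; last exact/ltW/om0.
  by have [? ? _] := LP x0; apply: Vd => //; exact: Hg.
(* By balance x / omega(x) = 1 / U(L(x)), which is nondecreasing in x, so its value at 1 bounds it
   on (0, 1]. *)
apply: (@le_lt_trans _ _ ((U (L 1))^-1)%:E); last exact: ltry.
rewrite limf_esupE; apply: (@le_trans _ _ (ereal_sup ((fun x => (x / omega x)%:E) @` `]0, 1]))).
  apply: ereal_inf_lbound; exists `]0, 1]%classic => //.
  exists 1; first exact: ltr01.
  move=> x; rewrite /ball_ /= sub0r normrN => x1 x0.
  by rewrite in_itv /= x0 (le_trans (ler_norm x) (ltW x1)).
apply: ge_ereal_sup => _ [x + <-]; rewrite /= in_itv /= => /andP[x0 x1].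
have [_ _] := LP x0; rewrite lee_fin /omega => ->.
rewrite invfM mulrA divff ?gt_eqF// mul1r lef_pV2 ?posrE ?uL0//.
exact: uL.
Unshelve. all: by end_near.
Qed.

Let near_right (g : R) : 0 < g -> \forall x \near 0^'+, 0 < x <= g.
Proof.
move=> g0; near=> x; apply/andP; split; near: x; first exact: nbhs_right_gt.
exact: nbhs_right_le.
Unshelve. all: by end_near.
Qed.

Lemma balance_cvg : L gamma @[gamma --> (0 : R)^'+] --> (0 : R)^'+.
Proof.
move=> A [e /= e0 HA]; have e2 : 0 < e / 2 by lra.
have [g g0 Hg] := balance_small e2.
apply: filterS (near_right g0) => x /andP[x0 xg]; have [l0 _ _] := LP x0.
apply: HA => //=; rewrite sub0r normrN gtr0_norm//.
by have := Hg _ x0 xg; lra.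
Qed.

Lemma balance_same_order :
  same_order (fun gamma => gamma * U (L gamma)) (fun gamma => V (L gamma)).
Proof.
exists 1, 1; split => //; apply: filterS (near_right ltr01) => x /andP[x0 _].
by have [_ _ ->] := LP x0; rewrite mul1r lexx.
Qed.

(** Monotonicity places omega between V(L'(gamma)) and gamma U(L'(gamma)), in an order that depends
    on whether L' <= L. If so, omega <= gamma U(L') <= l2 V(L') <= l2 omega; otherwise gamma U(L')
    <= omega <= V(L') <= gamma U(L') / l1. The constants cover both cases, which may alternate as
    gamma tends to 0. *)
Lemma same_order_balance (L' : R -> R) : L' gamma @[gamma --> (0 : R)^'+] --> (0 : R)^'+ ->
  same_order (fun gamma => gamma * U (L' gamma)) (fun gamma => V (L' gamma)) ->
  same_order omega (fun gamma => gamma * U (L' gamma)).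
Proof.
move=> cL' [l1 [l2 [l10 l20 H]]].
have l1' := ltW l10; have l2' := ltW l20.
exists (1 + l2)^-1, (1 + l1^-1); split; rewrite ?invr_gt0 ?addr_gt0 ?invr_gt0//.
have L'e : \forall g \near (0:R)^'+, 0 < L' g <= eps.
  by apply: (cL' [set s | 0 < s <= eps]); exact: near_right.
near=> g.
have g0 : 0 < g by near: g; exact: nbhs_right_gt.
have [l0 le E] := LP g0.
have /andP[l'0 l'e] : 0 < L' g <= eps by near: g.
have /andP[B1 B2] : l1 * V (L' g) <= g * U (L' g) <= l2 * V (L' g) by near: g.
have gU0 : 0 <= g * U (L' g) by rewrite mulr_ge0 ?(ltW g0)// U_ge0.
have om0 := V_ge0 le.
have l10' : 0 < l1^-1 by rewrite invr_gt0.
rewrite mulrC ler_pdivrMr ?addr_gt0//.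
have [c|c] := lerP (L' g) (L g).
  have V1 := V_le l'0 c le.
  have := ler_wpM2l (ltW g0) (U_le l'0 c le); rewrite -E => U1.
  have := ler_wpM2l l2' V1 => V2.
  have := mulr_ge0 (ltW l10') gU0.
  by rewrite /omega; move=> ?; apply/andP; split; lra.
have V1 := V_le l0 (ltW c) l'e.
have := ler_wpM2l (ltW g0) (U_le l0 (ltW c) l'e); rewrite -E => U1.
have : V (L' g) <= l1^-1 * (g * U (L' g)).
  by rewrite mulrC ler_pdivlMr// mulrC.
have := mulr_ge0 l2' om0.
by rewrite /omega; move=> ? ?; apply/andP; split; lra.
Unshelve. all: by end_near.
Qed.

End Balance.

(* The right-hand side is the increment over [x, 2x] of
   V(min(., s)) - gamma U(max(., s)), so that dyadic sums telescope. *)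
Lemma dyadic_term_le gamma s x t : 0 < gamma -> 0 < s -> s <= eps ->
  0 < x -> 2 * x <= eps -> 0 <= t ->
  t <= phi x / x ^+ k -> t <= gamma * (phi x / x ^+ k.+1) ->
  t <= 2 ^+ k.+2 * ((V (Num.min (2 * x) s) - gamma * U (Num.max (2 * x) s)) -
                    (V (Num.min x s) - gamma * U (Num.max x s))).
Proof.
move=> g0 s0 se x0 xe t0 tA tB.
have c0 m : 0 < 2 ^+ m :> R by rewrite exprn_gt0.
(* The right-hand side shows the length x of [x, 2x] times a lower bound of phi(t) / t^(m+1)
   there. *)
have pow m : phi x / x ^+ m = 2 ^+ m.+1 * (x * (phi x / (2 * x) ^+ m.+1)).
  rewrite exprMn [x ^+ m.+1]exprSr.
  have := lt0r_neq0 (c0 m.+1); have : x ^+ m != 0 by rewrite expf_neq0// gt_eqF.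
  move: (2 ^+ m.+1) (x ^+ m) => u v v0 u0; field.
  by rewrite v0 u0 gt_eqF.
have xe' : x <= eps by lra.
have px : 0 < phi x by exact: phi_gt0.
have p1 : 0 <= phi x / (2 * x) ^+ k.+1 by apply/ltW/quot_gt0; lra.
have p2 : 0 <= phi x / (2 * x) ^+ k.+2 by apply/ltW/quot_gt0; lra.
have tA' : t <= 2 ^+ k.+2 * (x * (phi x / (2 * x) ^+ k.+1)).
  apply: le_trans tA _; rewrite pow; apply: ler_wpM2r; first by rewrite mulr_ge0// ltW.
  by rewrite [leRHS]exprS; have := c0 k.+1; lra.
have tB' : t <= 2 ^+ k.+2 * (x * (gamma * (phi x / (2 * x) ^+ k.+2))).
  by apply: le_trans tB _; rewrite pow mulrCA [x * (gamma * _)]mulrCA.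
have C0 := c0 k.+2.
have VV y z : x <= y -> y <= z -> z <= 2 * x ->
    (z - y) * (phi x / (2 * x) ^+ k.+1) <= V z - V y.
  move=> xy yz zx; have y0 : 0 < y by lra.
  have /andP[+ _] := V_bounds y0 yz (le_trans zx xe).
  apply: le_trans; rewrite ler_wpM2l ?subr_ge0//.
  apply: ler_pM; [exact: ltW|rewrite invr_ge0 exprn_ge0//; lra|apply: phi_le => //; lra|].
  by rewrite lef_pV2 ?posrE ?exprn_gt0// ?lerXn2r ?nnegrE//; lra.
have UU y z : x <= y -> y <= z -> z <= 2 * x ->
    (z - y) * (gamma * (phi x / (2 * x) ^+ k.+2)) <= gamma * (U y - U z).
  move=> xy yz zx; have y0 : 0 < y by lra.
  rewrite mulrCA ler_wpM2l ?(ltW g0)//.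
  have /andP[+ _] := U_bounds y0 yz (le_trans zx xe).
  apply: le_trans; rewrite ler_wpM2l ?subr_ge0//.
  apply: ler_pM; [exact: ltW|rewrite invr_ge0 exprn_ge0//; lra|apply: phi_le => //; lra|].
  by rewrite lef_pV2 ?posrE ?exprn_gt0// ?lerXn2r ?nnegrE//; lra.
have gp2 : 0 <= gamma * (phi x / (2 * x) ^+ k.+2) by rewrite mulr_ge0// ltW.
move: (phi x / (2 * x) ^+ k.+1) (gamma * (phi x / (2 * x) ^+ k.+2)) (2 ^+ k.+2)
  p1 gp2 tA' tB' VV UU C0 => P1 P2 C P10 P20 tA' tB' VV UU C0.
have [xs|sx] := lerP (2 * x) s.
  have -> : Num.min x s = x by apply/min_idPl; lra.
  have -> : Num.max x s = s by apply/max_idPr; lra.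
  apply: le_trans tA' _; rewrite ler_wpM2l ?(ltW C0)//.
  by have := VV x (2 * x); lra.
have [sx'|xs'] := lerP s x.
  apply: le_trans tB' _; rewrite ler_wpM2l ?(ltW C0)//.
  by have := UU x (2 * x); lra.
have V1 := VV x s (lexx x) (ltW xs') (ltW sx).
have U1 := UU s (2 * x) (ltW xs') (ltW sx) (lexx _).
(* When s splits [x, 2x], t is the average of itself with weights (s - x)/x and (2x - s)/x; the
   first share is bounded by [tA'], the second by [tB']. *)
apply: (@le_trans _ _ (C * ((s - x) * P1 + (2 * x - s) * P2))); last first.
  by rewrite ler_wpM2l ?(ltW C0)//; lra.
rewrite -(ler_pM2l x0).
have := ler_wpM2l (_ : 0 <= s - x) tA'; have := ler_wpM2l (_ : 0 <= 2 * x - s) tB'.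
by rewrite !subr_ge0 => /(_ (ltW sx)) ? /(_ (ltW xs')) ?; lra.
Qed.

Lemma dyadic_sum_le gamma s (r t : nat -> R) N : 0 < gamma -> 0 < s -> s <= eps ->
  r 0%N = eps -> (forall m, 0 < r m) -> (forall m, r m = 2 * r m.+1) ->
  (forall m, 0 <= t m) ->
  (forall m, t m <= phi (r m.+1) / r m.+1 ^+ k) ->
  (forall m, t m <= gamma * (phi (r m.+1) / r m.+1 ^+ k.+1)) ->
  \sum_(m < N) t m <= 2 ^+ k.+2 * (V s + gamma * U s).
Proof.
move=> g0 s0 se rE r0 rS t0 tA tB.
have re m : r m <= eps.
  by elim: m => [|m IH]; [rewrite rE|have := rS m; have := r0 m.+1; lra].
(* At eps this equals V(s), because U(eps) = 0; at every r_N it is at least - gamma U(s). *)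
pose W x := V (Num.min x s) - gamma * U (Num.max x s).
apply: (@le_trans _ _ (2 ^+ k.+2 * (W eps - W (r N)))); last first.
  rewrite ler_wpM2l ?exprn_ge0// /W (min_idPr se) (max_idPl se) U_eps mulr0 subr0.
  have : U (Num.max (r N) s) <= U s by apply: U_le; rewrite ?le_max ?lexx ?orbT// ge_max re.
  move=> /(ler_wpM2l (ltW g0)); have := V_ge0 (_ : Num.min (r N) s <= eps).
  by rewrite ge_min re => /(_ isT); lra.
elim: N => [|N IH]; first by rewrite big_ord0 rE subrr mulr0.
rewrite big_ord_recr /=.
have : 2 * r N.+1 <= eps by rewrite -rS.
move=> /(dyadic_term_le g0 s0 se (r0 N.+1))/(_ (t0 N) (tA N) (tB N)).
by rewrite -rS -/(W (r N)) -/(W (r N.+1)); lra.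
Qed.

End BalancedRates.

(** * Proof of the theorem *)

(** Radii may exceed 1, where r^-j is not below r^-m; the factor E^m makes up for it, so derivatives
    of all orders share one power of r. *)
Lemma scaled_power_le (R : realFieldType) (K E r : R) (j m : nat) :
  1 <= K -> 1 <= E -> 0 < r -> r <= E -> (j <= m)%N ->
  (K / r) ^+ j <= (K * E) ^+ m / r ^+ m.
Proof.
move=> K1 E1 r0 rE jm.
have K0 : 0 <= K by lra.
have h : K / r <= K * E / r.
  by rewrite ler_pM2r ?invr_gt0//; rewrite ler_peMr.
have h1 : 1 <= K * E / r.
  rewrite ler_pdivlMr// mul1r; apply: le_trans rE _; rewrite ler_peMl//; lra.
apply: (@le_trans _ _ ((K * E / r) ^+ j)).
  by apply: lerXn2r; rewrite // nnegrE ?divr_ge0 ?mulr_ge0 ?(ltW r0)//; lra.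
by rewrite -expr_div_n ler_weXn2l.
Qed.

Lemma size_multi_index (n k : nat) (alpha : {ffun 'I_n -> 'I_k.+1}) :
  size (flatten [seq nseq (alpha i : nat) i | i <- enum 'I_n]) = (\sum_(i < n) alpha i)%N.
Proof.
rewrite size_flatten /shape sumnE -map_comp big_map big_enum /=.
by apply: eq_bigr => i _; rewrite size_nseq.
Qed.

Lemma Ck_modulus_of_bounds (R : realType) (n k : nat) (delta C : R) (varpi : R -> R)
    (f : 'rV[R]_n -> R) :
  is_Ck k f -> {in `]0, delta], forall x, 0 < varpi x} ->
  (forall s x, (size s <= k)%N -> `|iter_partial s f x| <= C) ->
  (forall s x y, (size s <= k)%N -> 0 < `|x - y| ->
     `|iter_partial s f x - iter_partial s f y| <= C * varpi `|x - y|) ->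
  Ck_modulus k delta varpi f.
Proof.
move=> fk varpi0 fb fm; split => //; apply/lte_sum_pinfty => alpha sal.
have sk : (size (flatten [seq nseq (alpha i : nat) i | i <- enum 'I_n]) <= k)%N.
  by rewrite size_multi_index.
apply: lte_add_pinfty; apply: (@le_lt_trans _ _ C%:E); rewrite ?ltry//.
  by apply: ge_ereal_sup => _ [x _ <-]; rewrite lee_fin; exact: fb.
apply: ge_ereal_sup => _ [[x y] /= /andP[xy0 xy1] <-]; rewrite lee_fin.
by rewrite ler_pdivrMr; [exact: fm|apply: varpi0; rewrite in_itv /= xy0].
Qed.

(** * Regularity of the limit function *)

Section StripSeries.
Context {R : realType} {n : nat}.
Variables (k : nat) (eps : R) (r : nat -> R) (phi omega : R -> R) (B0 : R).
Variables (F : nat -> 'rV[R[i]]_n -> R[i]) (f : 'rV[R]_n -> R).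
Hypothesis r_gt0 : forall m, 0 < r m.
Hypothesis r_le : forall m, r m.+1 <= r m.
Hypothesis r_eps : forall m, r m <= eps.
Hypothesis phi_ge0 : forall m, 0 <= phi (r m).
Hypothesis F_analytic : forall m, real_analytic_in_strip (r m) (F m).
Hypothesis F0 : forall z, strip (r 0%N) z -> F 0%N z = 0.
Hypothesis F_diff : forall nu, (1 <= nu)%N -> forall z, strip (r nu) z ->
  `|F nu z - F nu.-1 z| <= (phi (r nu))%:C.
Hypothesis F_lim : forall x : 'rV[R]_n,
  (F nu (cvect x) : R[i]^o) @[nu --> \oo] --> ((f x)%:C : R[i]^o).
Hypothesis sum_le : forall N, \sum_(m < N) phi (r m.+1) / r m.+1 ^+ k <= B0.
Hypothesis omega_cvg : omega x @[x --> (0 : R)^'+] --> (0 : R).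
Hypothesis sum_min_le : forall gamma N, 0 < gamma ->
  \sum_(m < N) Num.min (phi (r m.+1) / r m.+1 ^+ k)
     (gamma * (phi (r m.+1) / r m.+1 ^+ k.+1)) <= omega gamma.

Let G m (z : 'rV[R[i]]_n) := F m.+1 z - F m z.
Let g m (x : 'rV[R]_n) := complex.Re (G m (cvect x)).
Let E := Num.max 1 eps.
Let K : R := 2 * k.+1%:R.
(** K comes from Cauchy's estimate with step r/(k+1), and E bounds both 1 and every radius; the
    exponent covers derivatives up to order k + 1. *)
Let C := (K * E) ^+ k.+1.
Let b m := C * (phi (r m.+1) / r m.+1 ^+ k).

Let GL m z : strip (r m.+1) z -> locally_mpoly (G m) z.
Proof.
move=> zr; apply: locally_mpolyB; apply: analytic_locally_mpoly.
  by apply: (F_analytic m.+1).1.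
by apply: (F_analytic m).1; apply: le_trans (r_le m).
Qed.

Let GB m z : strip (r m.+1) z -> cabs (G m z) <= phi (r m.+1).
Proof. by move=> zr; have := @F_diff m.+1 isT z zr; rewrite cabsE lecR. Qed.

Let GLx m x : locally_mpoly (G m) (cvect x).
Proof. by apply: GL; apply: strip_cvect; exact: ltW. Qed.

Let g_derivable s : (size s <= k)%N -> forall m i x,
  derivable (iter_partial s (g m)) x (delta_mx 0 i).
Proof.
move=> _ m i x; rewrite iter_partial_Re//.
by case: (is_derive_Re i (locally_mpoly_iter s (GLx m x))).
Qed.

Let C_ge1 : 1 <= C.
Proof.
apply: exprn_ege1; apply: mulr_ege1; last by rewrite le_max lexx.
by have : 1 <= k.+1%:R :> R; [rewrite ler1n|rewrite /K; lra].
Qed.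

(** The exponent j is kept apart from the order of s: j = k gives one majorant for all orders up to
    k, and j = k + 1 bounds the partial derivatives of these. *)
Let g_bound_gen s m x j : (size s <= j)%N -> (j <= k.+1)%N ->
  `|iter_partial s (g m) x| <= C * (phi (r m.+1) / r m.+1 ^+ j).
Proof.
move=> sj jk; have sk := leq_trans sj jk.
have E1 : 1 <= E by rewrite le_max lexx.
have eE : eps <= E by rewrite le_max lexx orbT.
have K1 : 1 <= K by have : 1 <= k.+1%:R :> R; [rewrite ler1n|rewrite /K; lra].
apply: le_trans (iter_partial_Re_bound x (r_gt0 m.+1) (@GL m) (@GB m) sk) _.
rewrite [leRHS]mulrCA; apply: ler_wpM2l => //.
apply: le_trans (scaled_power_le K1 E1 (r_gt0 _) (le_trans (r_eps _) eE) sj) _.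
by rewrite ler_pM2r ?invr_gt0 ?exprn_gt0// ler_weXn2l// mulr_ege1.
Qed.

Let g_bound s : (size s <= k)%N -> forall m x, `|iter_partial s (g m) x| <= b m.
Proof. by move=> sk m x; apply: g_bound_gen. Qed.

Let b_bound N : \sum_(m < N) b m <= C * B0.
Proof. by rewrite -mulr_sumr ler_wpM2l//; have := C_ge1; lra. Qed.

Let f_sum x : (fun N => \sum_(m < N) g m x) @ \oo --> f x.
Proof.
apply/cvgrPdist_le => e e0; have := cvg_cabs (@F_lim x) e0.
apply: filterS => N; apply: le_trans.
have -> : \sum_(m < N) g m x = complex.Re (F N (cvect x)).
  elim: N => [|N IH]; first by rewrite big_ord0 F0//; apply: strip_cvect; exact: ltW.
  by rewrite big_ord_recr /= IH /g /G; case: (F N.+1 _) (F N _) => ? ? [? ?] /=; ring.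
by apply: le_trans (cabs_Re _); case: (F N _) => ? ?.
Qed.

Let quot_ge0 m j : 0 <= phi (r m.+1) / r m.+1 ^+ j.
Proof. by rewrite divr_ge0// exprn_ge0// ltW. Qed.

(** The increment of each term is at most twice its sup bound, and also at most its Lipschitz bound,
    which carries a factor n from the coordinate path; 2 + n serves both, and the minimum is
    summed. *)
Let modulus s x y : (size s <= k)%N -> 0 < `|x - y| ->
  `|iter_partial s f x - iter_partial s f y| <= (2 + n%:R) * C * omega `|x - y|.
Proof.
move=> sk gam0; set gam := `|x - y| in gam0 *.
have C1 := C_ge1.
apply: (series_modulus g_derivable g_bound b_bound f_sum sk (c := fun m => (2 + n%:R) * C *
  Num.min (phi (r m.+1) / r m.+1 ^+ k) (gam * (phi (r m.+1) / r m.+1 ^+ k.+1)))); last first.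
  move=> N; rewrite -mulr_sumr ler_wpM2l ?mulr_ge0 ?addr_ge0//; last exact: sum_min_le.
  lra.
move=> m; rewrite minr_pMr ?mulr_ge0 ?addr_ge0//; last lra.
rewrite le_min; apply/andP; split.
  apply: le_trans (ler_normB _ _) _.
  have := g_bound sk m x; have := g_bound sk m y; rewrite /b.
  have : 0 <= n%:R * C * (phi (r m.+1) / r m.+1 ^+ k).
    by apply: mulr_ge0 => //; rewrite mulr_ge0//; lra.
  lra.
apply: le_trans (@partial_bound_lipschitz _ _ _ (C * (phi (r m.+1) / r m.+1 ^+ k.+1)) _ _ _ _) _.
- by move=> i z; exact: g_derivable.
- by move=> i z; apply: (@g_bound_gen (i :: s)).
rewrite -/gam.
have : 0 <= C * (gam * (phi (r m.+1) / r m.+1 ^+ k.+1)).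
  by apply: mulr_ge0; [lra|apply: mulr_ge0 => //; exact: ltW].
lra.
Qed.

Lemma strip_series_regularity : is_Ck k f /\ exists M : R,
  (forall s x, (size s <= k)%N -> `|iter_partial s f x| <= M) /\
  (forall s x y, (size s <= k)%N -> 0 < `|x - y| ->
     `|iter_partial s f x - iter_partial s f y| <= M * omega `|x - y|).
Proof.
have C1 := C_ge1.
have C20 : 0 <= (2 + n%:R) * C by rewrite mulr_ge0 ?addr_ge0//; lra.
split; last first.
  exists (Num.max (C * B0) ((2 + n%:R) * C)); split => [s x sk|s x y sk xy].
    rewrite le_max; apply/orP; left.
    exact: (series_bound g_derivable g_bound b_bound f_sum).
  apply: le_trans (modulus sk xy) _; rewrite ler_wpM2r//; last by rewrite le_max lexx orbT.
  (* The empty sum gives nonnegativity of omega. *)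
  by have := sum_min_le 0 xy; rewrite big_ord0.
move=> s; split => [sk i x|sk x].
  exact: (series_derivable g_derivable g_bound b_bound f_sum).
apply/(@cvgrPdist_le _ _ _ (nbhs x)) => e e0.
have M0 : 0 < (2 + n%:R) * C + 1 by lra.
have /cvgrPdist_le /(_ _ (divr_gt0 e0 M0))[d /= d0 Hd] := omega_cvg.
apply/nbhs_ballP; exists d => // y; rewrite -ball_normE /= => xyd.
have [->|xy] := eqVneq x y; first by rewrite subrr normr0 ltW.
have gam0 : 0 < `|x - y| by rewrite normr_gt0 subr_eq0.
have := Hd `|x - y|; rewrite /= sub0r normrN normr_id => /(_ xyd gam0).
have om0 : 0 <= omega `|x - y| by have := sum_min_le 0 gam0; rewrite big_ord0.
rewrite sub0r normrN ger0_norm// ler_pdivlMr// => H.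
by apply: le_trans (modulus sk gam0) _; lra.
Qed.

End StripSeries.

Theorem theorem7 (R : realType) (n : nat) (eps a : R) (r : nat -> R)
    (phi : R -> R) (k : nat)
    (F : nat -> 'rV[R[i]]_n -> R[i]) (f : 'rV[R]_n -> R)
  (n_gt0 : (0 < n)%N)
  (eps_gt0 : 0 < eps)
  (rE : forall nu, r nu = eps * 2 ^- nu)
  (a_ge1 : 1 \in `[0, a])
  (a_ge_r : forall nu, r nu \in `[0, a])
  (phi_nondecreasing : {in `[0, a] &, {homo phi : x y / x <= y}})
  (phi_continuous : {within `[0, a], continuous phi})
  (phi0 : phi 0 = 0)
  (F_analytic : forall nu, real_analytic_in_strip (r nu) (F nu))
  (F0 : forall z, strip (r 0%N) z -> F 0%N z = 0)
  (F_diff : forall nu, (1 <= nu)%N -> forall z, strip (r nu) z ->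
     `|F nu z - F nu.-1 z| <= (phi (r nu))%:C)
  (F_lim : forall x : 'rV[R]_n,
     (F nu (cvect x) : R[i]^o) @[nu --> \oo] --> ((f x)%:C : R[i]^o))
  (int_cvg : (\int[lebesgue_measure]_(x in `]0%R, 1%R])
                (phi x / x ^+ k.+1)%:E < +oo)%E)
  (int_dvg : (\int[lebesgue_measure]_(x in `]0%R, 1%R])
                (phi x / x ^+ k.+2)%:E = +oo)%E) :
  exists (delta : R) (varpi : R -> R),
    [/\ is_modulus delta varpi,
        Ck_modulus k delta varpi f,
        exists L : R -> R, admissible k eps phi L &
        forall L : R -> R, admissible k eps phi L ->
          same_order varpi (upper_rate k eps phi L)].
Proof.
have a1 : 1 <= a by move: a_ge1; rewrite in_itv /= => /andP[].
have a0 : 0 < a by lra.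
have r0E : r 0%N = eps by rewrite rE expr0 invr1 mulr1.
have ea : eps <= a by have := a_ge_r 0%N; rewrite r0E in_itv /= => /andP[].
have rS m : r m = 2 * r m.+1.
  by rewrite !rE exprS invfM; field; rewrite expf_neq0.
have r_gt0 m : 0 < r m by rewrite rE divr_gt0// exprn_gt0.
have r_le m : r m.+1 <= r m by have := rS m; have := r_gt0 m.+1; lra.
have r_eps m : r m <= eps.
  by elim: m => [|m IH]; [rewrite r0E|exact: le_trans (r_le m) IH].
have phi_le x y : 0 < x -> x <= y -> y <= eps -> phi x <= phi y.
  by move=> x0 xy ye; apply: phi_nondecreasing => //; rewrite in_itv /=; lra.
have phi_gt0 x : 0 < x -> x <= eps -> 0 < phi x.
  move=> x0 xe.
  apply: (divergent_phi_gt0 phi_nondecreasing phi_continuous phi0 a1 int_dvg x0).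
  exact: le_trans ea.
pose U s := \int[lebesgue_measure]_(t in `[s, eps]) (phi t / t ^+ k.+2).
pose V s := \int[lebesgue_measure]_(t in `]0, s]) (phi t / t ^+ k.+1).
have V_bounds x y : 0 < x -> x <= y -> y <= eps ->
    (y - x) * (phi x / y ^+ k.+1) <= V y - V x <= (y - x) * (phi y / x ^+ k.+1).
  move=> x0 xy ye; have ya := le_trans ye ea.
  rewrite /V (integral_right_sub phi_nondecreasing phi_continuous phi0 a1 int_cvg x0 xy ya).
  exact: (phi_div_integral_bounds phi_nondecreasing phi_continuous phi0).
have U_bounds x y : 0 < x -> x <= y -> y <= eps ->
    (y - x) * (phi x / y ^+ k.+2) <= U x - U y <= (y - x) * (phi y / x ^+ k.+2).
  move=> x0 xy ye; have ya := le_trans ye ea.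
  rewrite /U (integral_left_sub phi_nondecreasing phi_continuous phi0 _ x0 xy ye ea).
  exact: (phi_div_integral_bounds phi_nondecreasing phi_continuous phi0).
have U_eps : U eps = 0 by rewrite /U set_itv1 Rintegral_set1.
have V_ge0 x : x <= eps -> 0 <= V x.
  move=> xe; apply: Rintegral_ge0 => t; rewrite /= in_itv /= => /andP[t0 tx].
  by rewrite divr_ge0 ?exprn_ge0 ?(ltW t0)//; apply/ltW/phi_gt0 => //; exact: le_trans xe.
have V_small e : 0 < e -> exists2 d, 0 < d & forall s, 0 < s -> s <= d -> V s <= e.
  exact: (integral_right_small a0 phi_nondecreasing phi_continuous phi0 a1 int_cvg).
have [L LP] := balance_function eps_gt0 phi_gt0 phi_le V_bounds U_bounds U_eps V_ge0 V_small.
have om_mod := balance_modulus eps_gt0 phi_gt0 V_bounds U_bounds U_eps V_ge0 V_small LP.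
exists 1, (fun gamma => V (L gamma)); split => //; last 2 first.
- exists L; split; last exact: balance_same_order LP.
  exact: (balance_cvg eps_gt0 phi_gt0 V_bounds U_bounds U_eps V_ge0 LP).
- move=> L' [cL' sL'].
  exact: (same_order_balance eps_gt0 phi_gt0 V_bounds U_bounds U_eps V_ge0 LP cL').
have dyadic := dyadic_sum_le phi_gt0 phi_le V_bounds U_bounds U_eps V_ge0.
case: om_mod => _ om_gt0 _ _ [om_cvg _].
(* The power of 2 is the dyadic constant; the last 2 arises because V and gamma U coincide at the
   balance point. *)
pose c : R := 2 ^+ k.+2 * 2.
have c0 : 0 < c by rewrite mulr_gt0// exprn_gt0.
have phi_r_ge0 m : 0 <= phi (r m) by exact/ltW/phi_gt0.
have quot_ge0 m j : 0 <= phi (r m.+1) / r m.+1 ^+ j by rewrite divr_ge0// exprn_ge0// ltW.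
have [||gamma N g0|fk [M [Mb Mm]]] := strip_series_regularity (k := k)
  (omega := fun x => c * V (L x)) (B0 := 2 ^+ k.+2 * (V eps + eps * U eps))
  r_gt0 r_le r_eps phi_r_ge0 F_analytic F0 F_diff F_lim.
(* With gamma = eps the bound involving gamma is the weaker one, since r_m <= eps, so the dyadic
   estimate applies to the series without minimum. *)
- move=> N; apply: (dyadic eps eps r (fun m => phi (r m.+1) / r m.+1 ^+ k)) => // m.
  rewrite (_ : phi (r m.+1) / r m.+1 ^+ k = r m.+1 * (phi (r m.+1) / r m.+1 ^+ k.+1)).
    by rewrite ler_wpM2r.
  by rewrite exprS invfM mulrCA [r m.+1 * (_ * _)]mulrA divff ?mul1r// gt_eqF.
- suff : c * V (L x) @[x --> (0 : R)^'+] --> c * 0 by rewrite mulr0.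
  by apply: cvgM; [exact: cvg_cst|].
- have [l0 le lE] := LP _ g0.
  rewrite /c -mulrA (_ : 2 * V (L gamma) = V (L gamma) + gamma * U (L gamma)); last first.
    by rewrite -lE mulr2n mulrDl mul1r.
  apply: (dyadic gamma (L gamma) r (fun m => Num.min (phi (r m.+1) / r m.+1 ^+ k)
    (gamma * (phi (r m.+1) / r m.+1 ^+ k.+1)))) => // m.
  + by rewrite le_min quot_ge0 mulr_ge0// ltW.
  + by rewrite ge_min lexx.
  + by rewrite ge_min lexx orbT.
apply: (@Ck_modulus_of_bounds _ _ _ _ (Num.max M (M * c))) => // [s x sk|s x y sk xy].
  by apply: le_trans (Mb s x sk) _; rewrite le_max lexx.
apply: le_trans (Mm s x y sk xy) _.
have [? ? _] := LP _ xy.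
by rewrite mulrA ler_wpM2r ?V_ge0// le_max lexx orbT.
Qed.
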